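(* Let $\rho>0$ and let $\varepsilon>0$ be a privacy parameter with $\varepsilon^{-1}=o(\log^{1/4} n)$. There is an $\varepsilon$-edge differentially private $(1+\rho)$-approximation algorithm for estimating the average degree $\bar d_G\ge 1$ of a graph $G$ on $n$ vertices, which runs in time $O\!\left(\sqrt{n}\cdot \mathrm{poly}(\log(n)/\rho)\cdot \mathrm{poly}(1/\varepsilon)\right)$.
   Context: Graphs are simple and undirected, $G=(V,E)$ with $|V|=n$, and $\bar d_G=\frac{1}{n}\sum_{v\in V}\deg(v)$. Access model (neighbor-query model): in constant time the algorithm may ask for $\deg(v)$ of any $v\in V$ (degree query), or for the identity of the $i$-th neighbor of $v$ (returning $\perp$ if $i>\deg(v)$). Running time and number of queries are used interchangeably. A $(1+\rho)$-approximation algorithm outputs a value $\tilde d$ such that with high probability $(1-\rho)\bar d_G\le \tilde d\le (1+\rho)\bar d_G$. Two graphs $G_1=(V,E_1)$, $G_2=(V,E_2)$ on the same vertex set are edge-neighboring if there is an edge $e$ with $E_1\setminus\{e\}=E_2\setminus\{e\}$. A randomized algorithm $\mathcal A$ is $\varepsilon$-edge differentially private if for every pair of edge-neighboring $n$-vertex graphs $G_1,G_2$ and every set $\mathcal S$ of outputs, $\Pr[\mathcal A(G_1)\in\mathcal S]\le e^{\varepsilon}\Pr[\mathcal A(G_2)\in\mathcal S]$. *)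

(* Defs.v *)
From HB Require Import structures.
From mathcomp Require Import all_boot all_order all_algebra.
From mathcomp Require Import all_classical all_reals all_analysis.

Set Implicit Arguments.
Unset Strict Implicit.
Unset Printing Implicit Defensive.

Import Order.TTheory GRing.Theory Num.Theory.
Import numFieldNormedType.Exports.

Local Open Scope classical_set_scope.
Local Open Scope ring_scope.

Record sgraph (n : nat) := SGraph {
  edges : {set {set 'I_n}} ;
  edges_card : forall e, e \in edges -> #|e| = 2%N }.

Definition nbhd (n : nat) (G : sgraph n) (v : 'I_n) : {set 'I_n} :=
  [set u | [set v; u]%SET \in edges G]%SET.

Definition deg (n : nat) (G : sgraph n) (v : 'I_n) : nat := #|nbhd G v|.

Definition avg_degree (R : realType) (n : nat) (G : sgraph n) : R :=
  (\sum_(v < n) (deg G v)%:R) / n%:R.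

Definition edge_neighboring (n : nat) (G1 G2 : sgraph n) : Prop :=
  exists2 e : {set 'I_n}, #|e| = 2%N &
    (edges G1 :\ e = edges G2 :\ e)%SET.

(* The query model does not say in which order the neighbors of a vertex are
   numbered.  A numbering is therefore kept as a parameter: it attaches to each
   graph and each vertex a duplicate-free list of the neighbors.  Algorithms
   are not allowed to depend on it, and their guarantees are required for all
   numberings. *)
Definition adj_lists (n : nat) (G : sgraph n) (l : 'I_n -> seq 'I_n) : Prop :=
  forall v, uniq (l v) /\ l v =i nbhd G v.

Definition numbering (n : nat) (L : sgraph n -> 'I_n -> seq 'I_n) : Prop :=
  forall G, adj_lists G (L G).

(* Deterministic adaptive query algorithms, as decision trees.  Neighbors are
   numbered from 0 in [NbrQuery], so that the answer is [None] (for "bottom")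
   iff [deg v <= i]. *)
Inductive qtree (R : Type) (n : nat) : Type :=
  | Output of R
  | DegQuery of 'I_n & (nat -> qtree R n)
  | NbrQuery of 'I_n & nat & (option 'I_n -> qtree R n).

Fixpoint result (R : Type) (n : nat) (G : sgraph n) (l : 'I_n -> seq 'I_n)
    (t : qtree R n) : R :=
  match t with
  | Output d => d
  | DegQuery v k => result G l (k (deg G v))
  | NbrQuery v i k => result G l (k (onth (l v) i))
  end.

Fixpoint nqueries (R : Type) (n : nat) (G : sgraph n) (l : 'I_n -> seq 'I_n)
    (t : qtree R n) : nat :=
  match t with
  | Output _ => 0
  | DegQuery v k => (nqueries G l (k (deg G v))).+1
  | NbrQuery v i k => (nqueries G l (k (onth (l v) i))).+1
  end.

(* A randomized algorithm is a random deterministic one: its coins are a point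
   of a probability space of its own, chosen independently of the input. *)
Record rand_alg (R : realType) (n : nat) := RandAlg {
  coin_disp : measure_display ;
  coins : measurableType coin_disp ;
  coin_law : probability coins R ;
  tree : coins -> qtree R n ;
  result_measurable : forall (G : sgraph n) (l : 'I_n -> seq 'I_n),
    adj_lists G l -> measurable_fun setT (fun w => result G l (tree w)) }.

Definition out_prob (R : realType) (n : nat) (A : rand_alg R n)
    (L : sgraph n -> 'I_n -> seq 'I_n) (G : sgraph n) (S : set R) : \bar R :=
  coin_law A [set w | S (result G (L G) (tree w))].

Definition edge_dp (R : realType) (n : nat) (eps : R) (A : rand_alg R n) :
    Prop :=
  forall L, numbering L -> forall G1 G2 : sgraph n, edge_neighboring G1 G2 ->
  forall S : set R, measurable S ->
    (out_prob A L G1 S <= (expR eps)%:E * out_prob A L G2 S)%E.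

(* "With high probability" means with probability 1 - o(1) as n tends to
   infinity, uniformly over the admissible inputs with n vertices. *)
Definition approximates_avg_degree (R : realType) (rho : R)
    (A : forall n, rand_alg R n) : Prop :=
  forall delta : R, 0 < delta ->
  \forall n \near \oo, forall L, numbering L ->
  forall G : sgraph n, 1 <= avg_degree R G ->
    ((1 - delta)%:E <= out_prob (A n) L G
      [set d : R | ((1 - rho) * avg_degree R G <= d <=
                    (1 + rho) * avg_degree R G)%R])%E.

Definition runs_within (R : realType) (n : nat) (A : rand_alg R n) (T : R) :
    Prop :=
  forall L, numbering L -> forall (G : sgraph n) (w : coins A),
    (nqueries G (L G) (tree w))%:R <= T.

(* Main.v *)
(* Estimator.  Write [d_v] for the degree of [v].  For a uniform vertex [v] and
   a uniform neighbor [u] of [v], the harmonic mean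
   [X = 2 d_v d_u / (d_v + d_u)] has expectation exactly the average degree (the
   weights [d_u / (d_v + d_u)] of the two orientations of an edge add up to 1),
   and its second moment, summed over the vertices, is at most [D^(3/2)] with
   [D = sum_v d_v].  So about [sqrt n] samples suffice.  The vertices are split
   into blocks of size [B] and one vertex is drawn in each block, so that no
   vertex is used twice.

   Sensitivity.  Passing from degree [b] to [b + 1] at one end multiplies [X] by
   at most [1 + 1/b], and at most [b] samples see that vertex as a neighbor.
   Hence changing one edge changes the sum of the truncated samples [min X T] by
   at most [4 T].

   Truncation.  The right [T] is of order [sqrt (n d)] with [d] the unknown
   average degree.  With [T_a = tau g^a] and [Phi a] the estimate truncated at
   [T_a], the algorithm takes the largest [a] such that [Phi a >= g^(2 a)], i.e.
   a solution of [Phi = d] on a geometric grid.  Since [Phi (a + 1) <= g Phi a],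
   this index changes by at most 1 when an edge changes.  Adding discrete
   Laplace noise [z] in a cyclic group to the index gives pure differential
   privacy, and a factor [g^(2 z)] close to 1 on the output.

   Since [rho] is fixed and [1/eps <= ln n] eventually, all parameters are
   chosen as powers of [ln n]; for small [n] the constant algorithm is used. *)

Require Import Defs.
From HB Require Import structures.
From mathcomp Require Import all_boot all_order all_algebra.
From mathcomp Require Import perm.
From mathcomp Require Import all_classical all_reals all_analysis.
From mathcomp Require Import ring lra zify.

Set Implicit Arguments.
Unset Strict Implicit.
Unset Printing Implicit Defensive.

Import Order.TTheory GRing.Theory Num.Theory.
Import numFieldNormedType.Exports.

Local Open Scope classical_set_scope.
Local Open Scope ring_scope.

(** * Finite probability *)

Record fdist (R : numDomainType) (T : finType) := FDist {
  fdist_fun :> T -> R ;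
  fdist_ge0 : forall w, 0 <= fdist_fun w ;
  fdist_sum1 : \sum_w fdist_fun w = 1 }.

Section Mean.
Context (R : realFieldType) (T : finType) (P : fdist R T).
Implicit Types (f g : T -> R) (A B : pred T) (a lam : R).

Definition mean f : R := \sum_w P w * f w.

Definition prob A : R := mean (fun w => (A w)%:R).

Lemma fdist_support_nonempty : exists w, 0 < P w.
Proof.
have := @psumr_neq0P _ T xpredT P (fun w _ => fdist_ge0 P w).
rewrite fdist_sum1; case=> [|w /andP[_ Pw]]; last by exists w.
by apply/eqP; exact: oner_neq0.
Qed.

Lemma eq_mean f g : f =1 g -> mean f = mean g.
Proof. by move=> fg; apply: eq_bigr => w _; rewrite fg. Qed.

Lemma ler_mean f g : (forall w, f w <= g w) -> mean f <= mean g.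
Proof. by move=> fg; apply: ler_sum => w _; rewrite ler_wpM2l ?fdist_ge0. Qed.

Lemma mean_cst a : mean (fun=> a) = a.
Proof. by rewrite /mean -mulr_suml fdist_sum1 mul1r. Qed.

Lemma meanD f g : mean (fun w => f w + g w) = mean f + mean g.
Proof. by rewrite -big_split; apply: eq_bigr => w _; rewrite mulrDr. Qed.

Lemma meanZ a f : mean (fun w => a * f w) = a * mean f.
Proof. by rewrite /mean mulr_sumr; apply: eq_bigr => w _; rewrite mulrCA. Qed.

Lemma mean_sum (I : finType) (F : I -> T -> R) :
  mean (fun w => \sum_i F i w) = \sum_i mean (F i).
Proof.
by rewrite /mean exchange_big; apply: eq_bigr => w _; rewrite mulr_sumr.
Qed.

Lemma mean_sqr_centered_le f :
  mean (fun w => (f w - mean f) ^+ 2) <= mean (fun w => f w ^+ 2).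
Proof.
rewrite (@eq_mean _ (fun w => f w ^+ 2 + (- 2 * mean f * f w + mean f ^+ 2))).
  rewrite 2!meanD meanZ mean_cst; have := sqr_ge0 (mean f); lra.
by move=> w; ring.
Qed.

Lemma prob_ge0 A : 0 <= prob A.
Proof. by apply: sumr_ge0 => w _; rewrite mulr_ge0 ?fdist_ge0. Qed.

Lemma prob_predU_le A B : prob (predU A B) <= prob A + prob B.
Proof.
rewrite -meanD; apply: ler_mean => w /=.
by rewrite -natrD ler_nat; case: (A w) (B w) => [] [].
Qed.

Lemma prob_ge_compl A B : (forall w, ~~ B w -> A w) -> 1 - prob B <= prob A.
Proof.
move=> AB; rewrite -(mean_cst 1) -mulN1r -meanZ -meanD; apply: ler_mean => w.
case: (boolP (B w)) => [_|/AB ->] /=; first by rewrite mulr1 subrr.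
by rewrite mulr0 addr0.
Qed.

Lemma prob_markov_sqr f lam : 0 < lam ->
  prob (fun w => lam <= `|f w|) <= mean (fun w => f w ^+ 2) / lam ^+ 2.
Proof.
move=> lam0; rewrite mulrC -meanZ; apply: ler_mean => w.
rewrite mulrC ler_pdivlMr ?exprn_gt0 //.
case: (leP lam `|f w|) => [lamf|_] /=.
  by rewrite mul1r -[leRHS](real_normK (num_real (f w))) lerXn2r ?nnegrE // ltW.
by rewrite mul0r sqr_ge0.
Qed.

End Mean.

Section Uniform.
Context (R : realFieldType) (T : finType) (T_gt0 : (0 < #|T|)%N).

Let unif_ge0 (w : T) : 0 <= #|T|%:R^-1 :> R.
Proof. by rewrite invr_ge0. Qed.

Let unif_sum1 : \sum_(w : T) #|T|%:R^-1 = 1 :> R.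
Proof. by rewrite sumr_const -[LHS]mulr_natl divff // pnatr_eq0 -lt0n. Qed.

Definition unif : fdist R T := FDist unif_ge0 unif_sum1.

Lemma mean_unif f : mean unif f = (\sum_w f w) / #|T|%:R.
Proof. by rewrite mulrC mulr_sumr. Qed.

End Uniform.

Section Product.
Context (R : realFieldType) (T1 T2 : finType).
Context (P : fdist R T1) (Q : fdist R T2).

Let prod_ge0 (w : T1 * T2) : 0 <= P w.1 * Q w.2.
Proof. by rewrite mulr_ge0 ?fdist_ge0. Qed.

Let prod_sum (f : T1 * T2 -> R) :
  \sum_w P w.1 * Q w.2 * f w = mean P (fun x => mean Q (fun y => f (x, y))).
Proof.
transitivity (\sum_x \sum_y P x * Q y * f (x, y)).
  by rewrite pair_bigA; apply: eq_bigr => -[].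
apply: eq_bigr => x _; rewrite [RHS]mulr_sumr.
by apply: eq_bigr => y _; rewrite mulrA.
Qed.

Let prod_sum1 : \sum_w P w.1 * Q w.2 = 1.
Proof.
have := prod_sum (fun=> 1); rewrite mean_cst mean_cst => <-.
by apply: eq_bigr => w _; rewrite mulr1.
Qed.

Definition fdist_prod : fdist R (T1 * T2)%type := FDist prod_ge0 prod_sum1.

Lemma mean_prod f :
  mean fdist_prod f = mean P (fun x => mean Q (fun y => f (x, y))).
Proof. exact: prod_sum. Qed.

Lemma prob_fst (A : pred T1) : prob fdist_prod (fun w => A w.1) = prob P A.
Proof. by rewrite [LHS]mean_prod; apply: eq_mean => x /=; exact: mean_cst. Qed.

Lemma prob_snd (A : pred T2) : prob fdist_prod (fun w => A w.2) = prob Q A.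
Proof. by rewrite [LHS]mean_prod /= mean_cst. Qed.

End Product.

Section Independent.
Context (R : realFieldType) (I T : finType) (P : I -> fdist R T).
Implicit Types (F : I -> T -> R) (lam : R).

Let ffun_ge0 (c : {ffun I -> T}) : 0 <= \prod_i P i (c i).
Proof. by apply: prodr_ge0 => i _; exact: fdist_ge0. Qed.

Let ffun_sum F : \sum_(c : {ffun I -> T}) \prod_i (P i (c i) * F i (c i)) =
  \prod_i mean (P i) (F i).
Proof. by rewrite (bigA_distr_bigA (fun i t => P i t * F i t)). Qed.

Let ffun_sum1 : \sum_(c : {ffun I -> T}) \prod_i P i (c i) = 1.
Proof.
rewrite -(bigA_distr_bigA (fun i t => P i t)) big1 // => i _.
exact: fdist_sum1.
Qed.

Definition fdist_ffun : fdist R {ffun I -> T} := FDist ffun_ge0 ffun_sum1.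

Lemma mean_ffun_prod F :
  mean fdist_ffun (fun c => \prod_i F i (c i)) = \prod_i mean (P i) (F i).
Proof. by rewrite -ffun_sum; apply: eq_bigr => c _; rewrite big_split. Qed.

Lemma mean_ffun (f : T -> R) i :
  mean fdist_ffun (fun c => f (c i)) = mean (P i) f.
Proof.
pose F j := if j == i then f else fun=> 1.
have := mean_ffun_prod F; rewrite [RHS](bigD1 i) //= {2}/F eqxx.
rewrite big1 ?mulr1 => [<-|j /negbTE ji]; last by rewrite /F ji mean_cst.
apply: eq_mean => c; rewrite (bigD1 i) //= {1}/F eqxx big1 ?mulr1 //.
by move=> j /negbTE ji; rewrite /F ji.
Qed.

Lemma mean_ffunM (f g : T -> R) i j : i != j ->
  mean fdist_ffun (fun c => f (c i) * g (c j)) = mean (P i) f * mean (P j) g.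
Proof.
move=> ij; have ji : j != i by rewrite eq_sym.
pose F k := if k == i then f else if k == j then g else fun=> 1.
have := mean_ffun_prod F.
rewrite [RHS](bigD1 i) //= [in RHS](bigD1 j) //= {2 3}/F !eqxx (negbTE ji).
rewrite big1 ?mulr1 => [<-|k /andP[/negbTE ki /negbTE kj]]; last first.
  by rewrite /F ki kj mean_cst.
apply: eq_mean => c; rewrite (bigD1 i) //= (bigD1 j) //=.
rewrite {1 2}/F !eqxx (negbTE ji) big1 ?mulr1 //.
by move=> k /andP[/negbTE ki /negbTE kj]; rewrite /F ki kj.
Qed.

Lemma mean_sqr_sum_centered F : (forall i, mean (P i) (F i) = 0) ->
  mean fdist_ffun (fun c => (\sum_i F i (c i)) ^+ 2) =
  \sum_i mean (P i) (fun t => F i t ^+ 2).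
Proof.
move=> F0; rewrite (@eq_mean _ _ _ _
  (fun c : {ffun I -> T} => \sum_i \sum_j F i (c i) * F j (c j))); last first.
  move=> c; rewrite expr2 mulr_suml; apply: eq_bigr => i _.
  by rewrite mulr_sumr.
rewrite mean_sum; apply: eq_bigr => i _; rewrite mean_sum (bigD1 i) //=.
under eq_mean do rewrite -expr2.
rewrite (mean_ffun (fun t => F i t ^+ 2)) big1 ?addr0 // => j ji.
by rewrite mean_ffunM ?F0 ?mul0r // eq_sym.
Qed.

Lemma prob_sum_chebyshev F lam : 0 < lam ->
  prob fdist_ffun
    (fun c => lam <= `|\sum_i F i (c i) - \sum_i mean (P i) (F i)|) <=
  (\sum_i mean (P i) (fun t => F i t ^+ 2)) / lam ^+ 2.
Proof.
move=> lam0; apply: le_trans (prob_markov_sqr _ _ lam0) _.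
rewrite ler_pM2r ?invr_gt0 ?exprn_gt0 //.
pose H i t := F i t - mean (P i) (F i).
under eq_mean do rewrite -sumrB.
rewrite (@mean_sqr_sum_centered H) => [|i].
  by apply: ler_sum => i _; exact: mean_sqr_centered_le.
by rewrite /H meanD mean_cst subrr.
Qed.

End Independent.

(* A measurable type must be pointed; the distribution provides the point. *)
Definition outcome (R : realFieldType) (T : finType) (P : fdist R T) : Type :=
  T.

Section FiniteLaw.
Context (R : realType) (T : finType) (P : fdist R T).

HB.instance Definition _ := Choice.on (outcome P).

HB.instance Definition _ :=
  isPointed.Build (outcome P) (sval (cid (fdist_support_nonempty P))).

HB.instance Definition _ :=
  @isMeasurable.Build default_measure_display (outcome P)
    discrete_measurable discrete_measurable0
    discrete_measurableC discrete_measurableU.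

Let atom (i : nat) : {measure set (outcome P) -> \bar R} :=
  if insub i is Some j then
    mscale (NngNum (fdist_ge0 P (enum_val (j : 'I_#|T|))))
      (@dirac _ (outcome P) (enum_val j) R)
  else mzero.

Definition finite_law : set (outcome P) -> \bar R := msum atom #|T|.

HB.instance Definition _ := Measure.on finite_law.

Lemma finite_lawE (S : set T) : finite_law S = (prob P (mem S))%:E.
Proof.
rewrite /finite_law /msum /prob /mean (reindex (@enum_val T T)) /=; last first.
  by apply: onW_bij; exact: enum_val_bij.
rewrite -sumEFin; apply: eq_bigr => i _.
by rewrite /atom valK EFinM -indicE.
Qed.

Let finite_law_setT : finite_law [set: outcome P] = 1%E.
Proof.
rewrite finite_lawE -[in RHS](mean_cst P 1); congr EFin.
by apply: eq_mean => w; rewrite inE in_setT.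
Qed.

HB.instance Definition _ :=
  Measure_isProbability.Build _ _ _ finite_law finite_law_setT.

Context (n : nat) (t : T -> qtree R n).

Let measurable_result (G : sgraph n) (l : 'I_n -> seq 'I_n) :
  adj_lists G l ->
  measurable_fun [set: outcome P] (fun w => result G l (t w)).
Proof. by []. Qed.

Definition finite_alg : rand_alg R n :=
  @RandAlg R n _ (outcome P) finite_law t measurable_result.

Lemma out_prob_finite_alg L G (S : set R) :
  out_prob finite_alg L G S =
  (prob P (fun w => result G (L G) (t w) \in S))%:E.
Proof. exact: finite_lawE. Qed.

End FiniteLaw.

(** * Query programs and degree sums *)

Section QueryPrograms.
Context (n : nat) (G : sgraph n) (l : 'I_n -> seq 'I_n).

Fixpoint qbind (A B : Type) (t : qtree A n) (k : A -> qtree B n) : qtree B n :=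
  match t with
  | Output a => k a
  | DegQuery v f => DegQuery v (fun d => qbind (f d) k)
  | NbrQuery v i f => NbrQuery v i (fun u => qbind (f u) k)
  end.

Fixpoint qseq (A : Type) (ts : seq (qtree A n)) : qtree (seq A) n :=
  if ts is t :: ts' then
    qbind t (fun x => qbind (qseq ts') (fun xs => Output n (x :: xs)))
  else Output n [::].

Lemma result_bind A B (t : qtree A n) (k : A -> qtree B n) :
  result G l (qbind t k) = result G l (k (result G l t)).
Proof. by elim: t => //= [v f IH|v i f IH]; rewrite IH. Qed.

Lemma nqueries_bind A B (t : qtree A n) (k : A -> qtree B n) :
  nqueries G l (qbind t k) =
  (nqueries G l t + nqueries G l (k (result G l t)))%N.
Proof. by elim: t => //= [v f IH|v i f IH]; rewrite IH. Qed.

Lemma result_seq A (ts : seq (qtree A n)) :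
  result G l (qseq ts) = [seq result G l t | t <- ts].
Proof. by elim: ts => //= t ts IH; rewrite !result_bind IH. Qed.

Lemma nqueries_seq A (ts : seq (qtree A n)) :
  nqueries G l (qseq ts) = sumn [seq nqueries G l t | t <- ts].
Proof.
by elim: ts => //= t ts IH; rewrite !nqueries_bind IH addn0.
Qed.

End QueryPrograms.

Section HarmonicMean.
Context (R : realFieldType).
Implicit Types x y z T : R.

(* Division by zero gives [hmean 0 0 = 0]. *)
Definition hmean x y : R := 2 * x * y / (x + y).

Lemma hmean0 y : hmean 0 y = 0.
Proof. by rewrite /hmean mulr0 !mul0r. Qed.

Lemma hmean_ge0 x y : 0 <= x -> 0 <= y -> 0 <= hmean x y.
Proof. by move=> x0 y0; rewrite divr_ge0 ?mulr_ge0 ?addr_ge0. Qed.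

Lemma hmean_sqr_le x y : 0 <= x -> 0 <= y -> hmean x y ^+ 2 <= x * y.
Proof.
move=> x0 y0; rewrite /hmean.
have [->|xy_neq0] := eqVneq (x + y) 0.
  by rewrite invr0 mulr0 expr0n mulr_ge0.
have xy_gt0 : 0 < x + y by rewrite lt_def xy_neq0 addr_ge0.
rewrite expr_div_n ler_pdivrMr ?exprn_gt0 //.
have := mulr_ge0 (mulr_ge0 x0 y0) (sqr_ge0 (x - y)); nra.
Qed.

Lemma hmean_divD x y : 0 < x -> 0 < y -> hmean x y / x + hmean y x / y = 2.
Proof. by move=> x0 y0; rewrite /hmean; field; rewrite !gt_eqF //; lra. Qed.

Lemma hmean_sqr_divD x y : 0 < x -> 0 < y ->
  hmean x y ^+ 2 / x + hmean y x ^+ 2 / y = 2 * hmean x y.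
Proof. by move=> x0 y0; rewrite /hmean; field; rewrite !gt_eqF //; lra. Qed.

Lemma hmean_le x y z : 0 <= x -> 0 < y -> y <= z -> hmean x y <= hmean x z.
Proof.
move=> x0 y0 yz; rewrite -subr_ge0.
have -> : hmean x z - hmean x y =
    2 * x ^+ 2 * (z - y) / ((x + y) * (x + z)).
  by rewrite /hmean; field; rewrite !gt_eqF //; lra.
by rewrite divr_ge0 ?mulr_ge0 ?sqr_ge0 //; lra.
Qed.

Lemma hmean_le_scale x y z : 0 <= x -> 0 < y -> y <= z ->
  hmean x z <= z / y * hmean x y.
Proof.
move=> x0 y0 yz; rewrite -subr_ge0.
have -> : z / y * hmean x y - hmean x z =
    2 * x * z * (z - y) / ((x + y) * (x + z)).
  by rewrite /hmean; field; rewrite !gt_eqF //; lra.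
by rewrite divr_ge0 ?mulr_ge0 //; lra.
Qed.

Lemma dist_min_hmean_le x y z T : 0 <= x -> 0 < y -> y <= z -> 0 <= T ->
  `|Num.min (hmean x y) T - Num.min (hmean x z) T| <= T * ((z - y) / y).
Proof.
move=> x0 y0 yz T0.
have mono := hmean_le x0 y0 yz; have growth := hmean_le_scale x0 y0 yz.
have mean_ge0 : 0 <= hmean x y by apply: hmean_ge0; lra.
have ratio_ge0 : 0 <= (z - y) / y by rewrite divr_ge0 //; lra.
rewrite distrC ger0_norm; last by rewrite subr_ge0 le_min2.
have [hT|/ltW Th] := leP (hmean x y) T; last first.
  by rewrite (min_idPr (le_trans Th mono)) subrr mulr_ge0.
apply: (@le_trans _ _ (hmean x y * ((z - y) / y))); last exact: ler_wpM2r.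
rewrite lerBlDl ge_min.
have -> : hmean x y + hmean x y * ((z - y) / y) = z / y * hmean x y.
  by field; rewrite gt_eqF.
by rewrite growth.
Qed.

End HarmonicMean.

Section Graph.
Context (R : realType) (n : nat).
Implicit Types (G : sgraph n) (u v : 'I_n).

Lemma nbhd_sym G u v : (u \in nbhd G v) = (v \in nbhd G u).
Proof. by rewrite !inE finset.setUC. Qed.

Lemma nbhd_irrefl G v : v \notin nbhd G v.
Proof.
by apply/negP; rewrite inE => /edges_card; rewrite finset.setUid cards1.
Qed.

Lemma deg_lt G v : (deg G v < n)%N.
Proof.
rewrite -[ltnRHS]card_ord -cardsT; apply: proper_card.
apply/properP; split; first exact/fintype.subsetP.
by exists v; [rewrite inE|exact: nbhd_irrefl].
Qed.

Lemma deg_gt0 G u v : u \in nbhd G v -> (0 < deg G v)%N.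
Proof. by move=> uv; rewrite /deg (cardD1 u) uv. Qed.

Definition rdeg G v : R := (deg G v)%:R.

Lemma rdeg_gt0 G u v : u \in nbhd G v -> 0 < rdeg G v.
Proof. by move=> /deg_gt0; rewrite ltr0n. Qed.

Definition deg_sum G : R := \sum_v rdeg G v.

Lemma avg_degreeE G : avg_degree R G = deg_sum G / n%:R.
Proof. by []. Qed.

Lemma deg_sum_ge0 G : 0 <= deg_sum G.
Proof. by rewrite sumr_ge0. Qed.

Lemma avg_degree_lt G : (0 < n)%N -> avg_degree R G < n%:R.
Proof.
move=> n_gt0; have n0 : 0 < n%:R :> R by rewrite ltr0n.
rewrite avg_degreeE ltr_pdivrMr // -[ltRHS]natrM -[X in (X * _)%N]card_ord.
rewrite natrM mulr_natl -sumr_const; apply: ltr_sum => [|v _].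
  by apply/hasP; exists (Ordinal n_gt0); rewrite ?mem_index_enum.
by rewrite ltr_nat deg_lt.
Qed.

Lemma sum_nbhd_cst G v (a : R) : \sum_(u in nbhd G v) a = a * rdeg G v.
Proof. by rewrite sumr_const mulr_natr. Qed.

Lemma sum_nbhd_symmetrize G (f g : 'I_n -> 'I_n -> R) :
  (forall u v, u \in nbhd G v -> f v u + f u v = 2 * g v u) ->
  \sum_v \sum_(u in nbhd G v) f v u = \sum_v \sum_(u in nbhd G v) g v u.
Proof.
move=> fg; apply: (@mulfI _ 2); rewrite // mulr2n mulrDl mul1r.
rewrite [X in _ + X = _](exchange_big_dep xpredT) //= -big_split mulr_sumr /=.
apply: eq_bigr => v _; rewrite mulr_sumr.
under [X in _ + X = _]eq_bigl => u do rewrite nbhd_sym.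
by rewrite -big_split; apply: eq_bigr => u; exact: fg.
Qed.

(* An isolated vertex gives [nbr_mean G f v = 0]. *)
Definition nbr_mean G (f : 'I_n -> R) v : R :=
  (\sum_(u in nbhd G v) f u) / rdeg G v.

Definition edge_hmean G v u : R := hmean (rdeg G v) (rdeg G u).

Lemma edge_hmean_ge0 G v u : 0 <= edge_hmean G v u.
Proof. exact: hmean_ge0. Qed.

Lemma sum_nbr_mean_hmean G :
  \sum_v nbr_mean G (edge_hmean G v) v = deg_sum G.
Proof.
under eq_bigr => v _ do rewrite /nbr_mean mulr_suml.
rewrite (sum_nbhd_symmetrize (g := fun _ _ => 1)) => [|u v uv].
  by apply: eq_bigr => v _; rewrite sum_nbhd_cst mul1r.
by rewrite mulr1 hmean_divD ?(rdeg_gt0 uv) // (@rdeg_gt0 _ v) // nbhd_sym.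
Qed.

Lemma sum_nbhd_degM_le G :
  \sum_v \sum_(u in nbhd G v) rdeg G v * rdeg G u <= deg_sum G ^+ 2.
Proof.
rewrite expr2 {1}/deg_sum mulr_suml; apply: ler_sum => v _.
rewrite -mulr_sumr ler_wpM2l // [leRHS](bigID (mem (nbhd G v))) /= lerDl.
exact: sumr_ge0.
Qed.

Lemma nbhd_deg_sum0 G v : deg_sum G = 0 -> nbhd G v =i pred0.
Proof.
move=> D0 u; apply/negP => /rdeg_gt0.
by rewrite (psumr_eq0P _ D0) // ltxx.
Qed.

(* AM-GM [2 h <= h^2 / s + s] with [s = sqrt (deg_sum G)]. *)
Lemma sum_nbhd_hmean_le G :
  \sum_v \sum_(u in nbhd G v) edge_hmean G v u <=
  deg_sum G * Num.sqrt (deg_sum G).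
Proof.
have [D0|D_neq0] := eqVneq (deg_sum G) 0.
  rewrite D0 mul0r sumr_le0 // => v _.
  by rewrite (eq_bigl _ _ (nbhd_deg_sum0 v D0)) big_pred0_eq.
set s := Num.sqrt _.
have s_gt0 : 0 < s by rewrite sqrtr_gt0 lt_def D_neq0 deg_sum_ge0.
have s2_gt0 : 0 < 2 * s by rewrite mulr_gt0.
have Ds : deg_sum G = s ^+ 2 by rewrite sqr_sqrtr ?deg_sum_ge0.
have amgm v u : edge_hmean G v u <=
    (2 * s)^-1 * (rdeg G v * rdeg G u) + s / 2.
  rewrite -(ler_pM2l s2_gt0) mulrDr mulVKf ?gt_eqF //.
  have := hmean_sqr_le (ler0n R (deg G v)) (ler0n R (deg G u)).
  have := sqr_ge0 (edge_hmean G v u - s); rewrite -/(edge_hmean _ _ _); lra.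
apply: (@le_trans _ _ (\sum_v ((2 * s)^-1 *
    (\sum_(u in nbhd G v) rdeg G v * rdeg G u) + s / 2 * rdeg G v))).
  apply: ler_sum => v _; rewrite mulr_sumr -sum_nbhd_cst -big_split.
  exact: ler_sum.
rewrite big_split /= -!mulr_sumr -/(deg_sum G).
have -> : deg_sum G * s = (2 * s)^-1 * deg_sum G ^+ 2 + s / 2 * deg_sum G.
  by rewrite Ds; field; rewrite gt_eqF.
by rewrite lerD2r ler_wpM2l ?sum_nbhd_degM_le // invr_ge0 ltW.
Qed.

Lemma sum_nbr_mean_hmean_sqr_le G :
  \sum_v nbr_mean G (fun u => edge_hmean G v u ^+ 2) v <=
  deg_sum G * Num.sqrt (deg_sum G).
Proof.
under eq_bigr => v _ do rewrite /nbr_mean mulr_suml.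
rewrite (sum_nbhd_symmetrize (g := edge_hmean G)) => [|u v uv].
  exact: sum_nbhd_hmean_le.
by rewrite hmean_sqr_divD ?(rdeg_gt0 uv) // (@rdeg_gt0 _ v) // nbhd_sym.
Qed.

End Graph.

(** * Probing a vertex *)

Section BlockSums.
Context (R : realType).

Lemma sum_blocks (f : nat -> R) k m :
  \sum_(j < k) \sum_(x < m) f (j * m + x)%N = \sum_(i < k * m) f i.
Proof.
rewrite -(big_mkord xpredT f) big_nat_mul big_mkord; apply: eq_bigr => j _.
rewrite -[X in index_iota X _]add0n big_addn mulSn addnK big_mkord.
by apply: eq_bigr => x _; rewrite addnC.
Qed.

Lemma sum_block_choice_le (f : nat -> R) k m (x : 'I_k -> 'I_m) :
  (forall i, 0 <= f i) ->
  \sum_(j < k) f (j * m + x j)%N <= \sum_(i < k * m) f i.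
Proof.
move=> f0; rewrite -sum_blocks; apply: ler_sum => j _.
by rewrite (bigD1 (x j)) //= lerDl sumr_ge0.
Qed.

Lemma sum_modn (f : nat -> R) d K : (0 < d)%N -> (d %| K)%N ->
  \sum_(r < K) f (r %% d)%N = (K %/ d)%:R * \sum_(i < d) f i.
Proof.
move=> d0 dK; have := sum_blocks (fun r => f (r %% d)%N) (K %/ d) d.
rewrite (divnK dK) => <-; rewrite mulr_natl -[X in _ *+ X]card_ord -sumr_const.
apply: eq_bigr => j _.
by apply: eq_bigr => i _; rewrite modnMDl modn_small.
Qed.

(* The last block of vertices may overrun [n]. *)
Definition extend0 n (f : 'I_n -> R) (i : nat) : R := oapp f 0 (insub i).

Lemma extend0_ord n (f : 'I_n -> R) (v : 'I_n) : extend0 f v = f v.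
Proof. by rewrite /extend0 valK. Qed.

Lemma extend0_ge0 n (f : 'I_n -> R) i :
  (forall v, 0 <= f v) -> 0 <= extend0 f i.
Proof. by move=> f0; rewrite /extend0; case: insub => /=. Qed.

Lemma sum_extend0 n (f : 'I_n -> R) m : (n <= m)%N ->
  \sum_(i < m) extend0 f i = \sum_v f v.
Proof.
move=> nm; rewrite -(big_mkord xpredT (extend0 f)) (@big_cat_nat _ _ _ n) //=.
rewrite [X in _ + X]big_nat [X in _ + X]big1 ?addr0 => [|i /andP[ni _]].
  by rewrite big_mkord; apply: eq_bigr => v _; rewrite extend0_ord.
by rewrite /extend0 insubF // ltnNge ni.
Qed.

End BlockSums.

Lemma perm_eq_nth_modn (T : eqType) (x0 : T) (s t : seq T) K :
  perm_eq s t -> (0 < size s -> size s %| K)%N ->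
  exists f : 'I_K -> 'I_K, injective f /\
    forall r, nth x0 s (f r %% size s) = nth x0 t (r %% size t).
Proof.
move=> st dvdK; rewrite -(perm_size st).
have [/size0nil s_nil|d_gt0] := posnP (size s).
  exists id; split=> // r.
  by move: st; rewrite s_nil perm_sym => /perm_nilP ->.
have dK := dvdK d_gt0; set d := size s in d_gt0 dK *.
have /tuple_permP[p t_eq] : perm_eq t (in_tuple s) by rewrite perm_sym.
have nth_t (i : 'I_d) : nth x0 t i = nth x0 s (p i).
  rewrite t_eq (nth_map i) ?size_enum_ord // nth_ord_enum.
  by rewrite (tnth_nth x0).
pose rem r : 'I_d := Ordinal (ltn_pmod r d_gt0).
have f_lt (r : 'I_K) : (r %/ d * d + p (rem r) < K)%N.
  apply: (@leq_trans ((r %/ d).+1 * d)).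
    by rewrite mulSn addnC ltn_add2r.
  by rewrite -[leqRHS](divnK dK) leq_mul2r ltn_divLR // divnK // ltn_ord orbT.
exists (fun r => Ordinal (f_lt r)); split=> [r1 r2 /(congr1 val) /= f12|r] /=.
  have div12 : (r1 %/ d = r2 %/ d)%N.
    have := congr1 (divn^~ d) f12.
    by rewrite !divnMDl // !(divn_small (ltn_ord _)) !addn0.
  have /val_inj/perm_inj/(congr1 val) /= mod12 : p (rem r1) = p (rem r2) :> nat.
    by move/eqP: f12; rewrite div12 eqn_add2l => /eqP.
  by apply: val_inj; rewrite /= (divn_eq r1 d) (divn_eq r2 d) div12 mod12.
by rewrite modnMDl modn_small // -(nth_t (rem r)).
Qed.

Section Probe.
Context (R : realType) (n : nat).
Implicit Types (G : sgraph n) (l : 'I_n -> seq 'I_n) (v : 'I_n).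

Lemma size_adj_lists G l v : adj_lists G l -> size (l v) = deg G v.
Proof. by move=> /(_ v)[/card_uniqP <- /eq_card ->]. Qed.

Definition cyclic_nbr G l v (r : nat) : 'I_n := nth v (l v) (r %% deg G v).

Lemma cyclic_nbr_nbhd G l v r : adj_lists G l -> (0 < deg G v)%N ->
  cyclic_nbr G l v r \in nbhd G v.
Proof.
move=> Gl d0; have [_ <-] := Gl v.
by rewrite mem_nth // (size_adj_lists v Gl) ltn_pmod.
Qed.

Lemma sum_cyclic_nbr G l (f : 'I_n -> R) v K : adj_lists G l ->
  (0 < deg G v)%N -> (deg G v %| K)%N ->
  \sum_(r < K) f (cyclic_nbr G l v r) = K%:R * nbr_mean G f v.
Proof.
move=> Gl d0 dK; rewrite (sum_modn (fun i => f (nth v (l v) i)) d0 dK).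
rewrite natf_div // /nbr_mean mulrAC mulrA; congr (_ * _ / _).
rewrite -(size_adj_lists v Gl) -(big_mkord xpredT (fun i => f (nth v (l v) i))).
rewrite -(big_nth v xpredT f) big_uniq ?(Gl v).1 //=.
by apply: eq_bigl => u; rewrite (Gl v).2.
Qed.

Lemma cyclic_nbr_coupling G1 G2 l1 l2 v K :
  adj_lists G1 l1 -> adj_lists G2 l2 -> nbhd G1 v = nbhd G2 v ->
  (0 < deg G1 v -> deg G1 v %| K)%N ->
  exists f : 'I_K -> 'I_K, injective f /\
    forall r, cyclic_nbr G1 l1 v (f r) = cyclic_nbr G2 l2 v r.
Proof.
move=> Gl1 Gl2 N12 dK; rewrite /cyclic_nbr.
rewrite -(size_adj_lists v Gl1) -(size_adj_lists v Gl2).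
apply: perm_eq_nth_modn; last by rewrite (size_adj_lists v Gl1).
have [uniq1 mem1] := Gl1 v; have [uniq2 mem2] := Gl2 v.
by apply: uniq_perm => // u; rewrite mem1 N12 mem2.
Qed.

Definition probe_value G l (i r : nat) : R :=
  extend0 (fun v => edge_hmean R G v (cyclic_nbr G l v r)) i.

Lemma probe_value_ge0 G l i r : 0 <= probe_value G l i r.
Proof. by apply: extend0_ge0 => v; exact: edge_hmean_ge0. Qed.

Lemma edge_hmean_isolated G v u : deg G v = 0%N -> edge_hmean R G v u = 0.
Proof. by move=> d0; rewrite /edge_hmean /rdeg d0 hmean0. Qed.

Definition probe (i r : nat) : qtree R n :=
  if insub i is Some v then
    DegQuery v (fun d =>
      NbrQuery v (r %% d) (fun o =>
        if o is Some u then
          DegQuery u (fun d' => Output n (hmean d%:R d'%:R))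
        else Output n 0))
  else Output n 0.

Lemma result_probe G l i r : adj_lists G l ->
  result G l (probe i r) = probe_value G l i r.
Proof.
move=> Gl; rewrite /probe /probe_value /extend0; case: insub => //= v.
case nth_r: (onth _ _) => [u|] /=.
  by rewrite /edge_hmean /rdeg /cyclic_nbr (@onth_nth _ v _ _ _ nth_r).
have := onthNE (l v) (r %% deg G v); rewrite nth_r (size_adj_lists v Gl) /=.
have [d0 _|d0] := posnP (deg G v); first by rewrite edge_hmean_isolated.
by rewrite leqNgt ltn_pmod.
Qed.

Lemma nqueries_probe_le3 G l i r : (nqueries G l (probe i r) <= 3)%N.
Proof. by rewrite /probe; case: insub => //= v; case: onth. Qed.

End Probe.

(** * Sensitivity to one edge *)

Section EdgeNeighbors.
Context (n : nat) (G1 G2 : sgraph n) (e : {set 'I_n}).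
Hypothesis agree_off_e : (edges G1 :\ e = edges G2 :\ e)%SET.

Lemma mem_edges_neighboring f :
  f != e -> (f \in edges G1) = (f \in edges G2).
Proof.
move=> fe; have := congr1 (fun A : {set _} => f \in A) agree_off_e.
by rewrite !inE fe.
Qed.

Lemma edges_subset_total :
  edges G1 \subset edges G2 \/ edges G2 \subset edges G1.
Proof.
have [eE|eE] := boolP (e \in edges G2); [left|right].
- by rewrite -(finset.setD1K eE) -agree_off_e -subDset.
- apply/fintype.subsetP => f fE; rewrite mem_edges_neighboring //.
  by apply: contraNneq eE => <-.
Qed.

Lemma nbhd_notin_edge v : v \notin e -> nbhd G1 v = nbhd G2 v.
Proof.
move=> ve; apply/finset.setP => u; rewrite !inE mem_edges_neighboring //.
by apply: contraNneq ve => <-; rewrite !inE eqxx.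
Qed.

Lemma deg_neighboring_leS v : #|e| = 2%N -> (deg G2 v <= (deg G1 v).+1)%N.
Proof.
move=> card_e; have [ve|ve] := boolP (v \in e); last first.
  by rewrite /deg (nbhd_notin_edge ve).
have card_other : #|(e :\ v)%SET| = 1%N.
  by have := cardsD1 v e; rewrite ve card_e => -[].
rewrite -addn1 -card_other; apply: leq_trans (leq_card_setU _ _).
apply: subset_leq_card; apply/fintype.subsetP => u; rewrite !inE => vuE.
have [vu_e|vu_neq] := eqVneq [set v; u]%SET e.
  rewrite -vu_e !inE eqxx orbT andbT; apply/orP; right.
  apply: contraTneq isT => uv.
  by move: card_e; rewrite -vu_e uv finset.setUid cards1.
by rewrite mem_edges_neighboring ?vuE.
Qed.

End EdgeNeighbors.

Lemma deg_subset n (G1 G2 : sgraph n) v :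
  edges G1 \subset edges G2 -> (deg G1 v <= deg G2 v)%N.
Proof.
move=> /fintype.subsetP sub12; apply: subset_leq_card.
by apply/fintype.subsetP => u; rewrite !inE; exact: sub12.
Qed.

Section Sensitivity.
Context (R : realType) (n : nat).
Implicit Types (G : sgraph n) (l : 'I_n -> seq 'I_n) (u v : 'I_n).
Implicit Types (e : {set 'I_n}) (T : R).

(* An end [x] of [e] is seen as a neighbor by only [deg x] probes, and a change
   of its degree moves each of them by at most [T / deg x]. *)
Definition edge_sens G e T v : R :=
  \sum_(x in e) (T * (v == x)%:R + T / rdeg R G x * (v \in nbhd G x)%:R).

Let sens_term_ge0 G T v x : 0 <= T ->
  0 <= T * (v == x)%:R + T / rdeg R G x * (v \in nbhd G x)%:R.
Proof. by move=> T0; rewrite addr_ge0 ?mulr_ge0 ?invr_ge0. Qed.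

Lemma edge_sens_ge0 G e T v : 0 <= T -> 0 <= edge_sens G e T v.
Proof. by move=> T0; apply: sumr_ge0 => x _; exact: sens_term_ge0. Qed.

Lemma edge_sens_endpoint G e T v : 0 <= T -> v \in e ->
  T <= edge_sens G e T v.
Proof.
move=> T0 ve; rewrite /edge_sens (bigD1 v) //= eqxx mulr1 -addrA lerDl.
rewrite addr_ge0 ?mulr_ge0 ?invr_ge0 ?sumr_ge0 // => x _.
exact: sens_term_ge0.
Qed.

Lemma edge_sens_adjacent G e T v x : 0 <= T -> x \in e -> v \in nbhd G x ->
  T / rdeg R G x <= edge_sens G e T v.
Proof.
move=> T0 xe xv; rewrite /edge_sens (bigD1 x) //= xv mulr1 addrAC addrC lerDl.
by rewrite addr_ge0 ?mulr_ge0 ?sumr_ge0 // => y _; exact: sens_term_ge0.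
Qed.

Lemma sum_edge_sens_le G e T : 0 <= T -> #|e| = 2%N ->
  \sum_v edge_sens G e T v <= 4 * T.
Proof.
move=> T0 card_e; rewrite exchange_big /=.
have -> : 4 * T = \sum_(x in e) (2 * T).
  by rewrite sumr_const card_e -mulr_natr; ring.
apply: ler_sum => x _; rewrite big_split /= -!mulr_sumr.
have -> : \sum_v (v == x)%:R = 1 :> R.
  by rewrite (bigD1 x) //= eqxx big1 ?addr0 // => v /negbTE ->.
have -> : \sum_v (v \in nbhd G x)%:R = rdeg R G x.
  rewrite -[RHS]mul1r -sum_nbhd_cst [RHS]big_mkcond; apply: eq_bigr => v _.
  by case: (v \in _).
have [->|deg_neq0] := eqVneq (rdeg R G x) 0; first by rewrite mulr0; lra.
by rewrite divfK //; lra.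
Qed.

Lemma min_ge0_le (x T : R) : 0 <= x -> 0 <= T -> 0 <= Num.min x T <= T.
Proof. by move=> x0 T0; rewrite le_min x0 T0 ge_min lexx orbT. Qed.

Section Deletion.
Context (G1 G2 : sgraph n) (l1 l2 : 'I_n -> seq 'I_n) (e : {set 'I_n}) (T : R).
Hypotheses (Gl1 : adj_lists G1 l1) (card_e : #|e| = 2%N) (T_ge0 : 0 <= T)
  (agree_off_e : (edges G1 :\ e = edges G2 :\ e)%SET)
  (sub12 : edges G1 \subset edges G2).

Lemma dist_min_edge_hmean_le v u : v \notin e -> u \in nbhd G1 v ->
  `|Num.min (edge_hmean R G1 v u) T - Num.min (edge_hmean R G2 v u) T|
    <= edge_sens G1 e T v.
Proof.
move=> ve uv; rewrite /edge_hmean.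
have rdeg_notin w : w \notin e -> rdeg R G2 w = rdeg R G1 w.
  by move=> we; rewrite /rdeg /deg (nbhd_notin_edge agree_off_e we).
rewrite (rdeg_notin _ ve); have [ue|ue] := boolP (u \in e); last first.
  by rewrite (rdeg_notin _ ue) subrr normr0 edge_sens_ge0.
rewrite nbhd_sym in uv; have du := rdeg_gt0 R uv.
apply: le_trans (edge_sens_adjacent T_ge0 ue uv).
apply: le_trans (dist_min_hmean_le _ du _ T_ge0) _ => //.
  by rewrite ler_nat deg_subset.
rewrite mulrA ler_pM2r ?invr_gt0 // -[leRHS]mulr1 ler_wpM2l //.
by rewrite lerBlDl natr1 ler_nat; exact: (deg_neighboring_leS agree_off_e).
Qed.

Lemma dist_min_probe_value_le v r1 r2 :
  (v \notin e -> cyclic_nbr G1 l1 v r1 = cyclic_nbr G2 l2 v r2) ->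
  `|Num.min (probe_value R G1 l1 v r1) T - Num.min (probe_value R G2 l2 v r2) T|
    <= edge_sens G1 e T v.
Proof.
move=> same_nbr; have [ve|ve] := boolP (v \in e).
  apply: le_trans (edge_sens_endpoint G1 T_ge0 ve).
  have /andP[x0 xT] := min_ge0_le (probe_value_ge0 R G1 l1 v r1) T_ge0.
  have /andP[y0 yT] := min_ge0_le (probe_value_ge0 R G2 l2 v r2) T_ge0.
  by rewrite ler_norml; lra.
rewrite /probe_value !extend0_ord -(same_nbr ve).
have [deg1|deg1] := posnP (deg G1 v).
  have deg2 : deg G2 v = 0%N by rewrite /deg -(nbhd_notin_edge agree_off_e ve).
  by rewrite !edge_hmean_isolated // subrr normr0 edge_sens_ge0.
exact/dist_min_edge_hmean_le/cyclic_nbr_nbhd.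
Qed.

End Deletion.
End Sensitivity.

Section Sampling.
Context (R : realType) (n k B K : nat).
Implicit Types (G : sgraph n) (l : 'I_n -> seq 'I_n) (T : R).
Implicit Type e : {set 'I_n}.

Definition sampling := {ffun 'I_k -> 'I_B * 'I_K}.

Definition sample_index (c : sampling) (j : 'I_k) : nat := (j * B + (c j).1)%N.

Definition sample_sum G l (phi : R -> R) (c : sampling) : R :=
  \sum_j phi (probe_value R G l (sample_index c j) (c j).2).

Definition relabel (f : nat -> 'I_K -> 'I_K) (c : sampling) : sampling :=
  [ffun j => ((c j).1, f (sample_index c j) (c j).2)].

Lemma relabel_inj f : (forall i, injective (f i)) -> injective (relabel f).
Proof.
move=> f_inj c1 c2 /ffunP c12; apply/ffunP => j; have := c12 j.
rewrite !ffunE /sample_index.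
by case: (c1 j) (c2 j) => [x1 r1] [x2 r2] /= [<- /f_inj ->].
Qed.

Definition coupled e G1 l1 (c1 : sampling)
    G2 l2 (c2 : sampling) : Prop :=
  forall j, (c1 j).1 = (c2 j).1 /\
    forall v : 'I_n, v = sample_index c1 j :> nat -> v \notin e ->
    cyclic_nbr G1 l1 v (c1 j).2 = cyclic_nbr G2 l2 v (c2 j).2.

Lemma coupled_sym e G1 l1 c1 G2 l2 c2 :
  coupled e G1 l1 c1 G2 l2 c2 -> coupled e G2 l2 c2 G1 l1 c1.
Proof.
move=> c12 j; have [vertex nbr] := c12 j; split=> // v vj ve.
by rewrite nbr // vj /sample_index vertex.
Qed.

Hypothesis nkB : (n <= k * B)%N.

Lemma dist_sample_sum_subset_le G1 G2 l1 l2 e T c1 c2 :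
  adj_lists G1 l1 -> #|e| = 2%N -> 0 <= T ->
  (edges G1 :\ e = edges G2 :\ e)%SET ->
  edges G1 \subset edges G2 -> coupled e G1 l1 c1 G2 l2 c2 ->
  `|sample_sum G1 l1 (Num.min^~ T) c1 - sample_sum G2 l2 (Num.min^~ T) c2|
    <= 4 * T.
Proof.
move=> Gl1 card_e T0 agree_off_e sub12 c12; rewrite /sample_sum -sumrB.
apply: le_trans (ler_norm_sum _ _ _) _.
apply: le_trans (sum_edge_sens_le G1 T0 card_e); rewrite -(sum_extend0 _ nkB).
apply: le_trans (sum_block_choice_le (fun j => (c1 j).1) _); last first.
  by move=> i; apply: extend0_ge0 => v; exact: edge_sens_ge0.
apply: ler_sum => j _; have [vertex nbr] := c12 j.
have -> : sample_index c2 j = sample_index c1 j by rewrite /sample_index vertex.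
rewrite -/(sample_index c1 j); case: (insubP 'I_n (sample_index c1 j)).
  move=> v _ vj; rewrite -vj extend0_ord; apply: dist_min_probe_value_le => //.
  exact: nbr.
by move=> nv; rewrite /probe_value /extend0 !insubN // subrr normr0.
Qed.

Lemma dist_sample_sum_le G1 G2 l1 l2 e T c1 c2 :
  adj_lists G1 l1 -> adj_lists G2 l2 -> #|e| = 2%N -> 0 <= T ->
  (edges G1 :\ e = edges G2 :\ e)%SET -> coupled e G1 l1 c1 G2 l2 c2 ->
  `|sample_sum G1 l1 (Num.min^~ T) c1 - sample_sum G2 l2 (Num.min^~ T) c2|
    <= 4 * T.
Proof.
move=> Gl1 Gl2 card_e T0 agree_off_e c12.
have [sub|sub] := edges_subset_total agree_off_e.
  exact: dist_sample_sum_subset_le c12.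
by rewrite distrC; apply: dist_sample_sum_subset_le (coupled_sym c12).
Qed.

Hypothesis dvdK : forall d, (0 < d < n)%N -> (d %| K)%N.

Lemma exists_coupling G1 G2 l1 l2 e :
  adj_lists G1 l1 -> adj_lists G2 l2 -> (edges G1 :\ e = edges G2 :\ e)%SET ->
  exists2 f : nat -> 'I_K -> 'I_K, forall i, injective (f i) &
    forall c, coupled e G1 l1 (relabel f c) G2 l2 c.
Proof.
move=> Gl1 Gl2 agree_off_e.
have local_coupling (i : nat) : exists f : 'I_K -> 'I_K, injective f /\
    forall v : 'I_n, v = i :> nat -> v \notin e ->
      forall r, cyclic_nbr G1 l1 v (f r) = cyclic_nbr G2 l2 v r.
  case: (insubP 'I_n i) => [v _ vi|i_ge_n]; last first.
    by exists id; split=> // v vi; rewrite -vi ltn_ord in i_ge_n.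
  have unique (w : 'I_n) : w = i :> nat -> w = v.
    by move=> wi; apply: val_inj; rewrite /= wi.
  have [ve|ve] := boolP (v \in e).
    by exists id; split=> // w /unique ->; rewrite ve.
  have [d_gt0|f [f_inj fP]] :=
    cyclic_nbr_coupling (K := K) Gl1 Gl2 (nbhd_notin_edge agree_off_e ve).
    by apply: dvdK; rewrite d_gt0 deg_lt.
  by exists f; split=> // w /unique ->.
have [f fP] := choice local_coupling; exists f => [i|c j].
  by have [] := fP i.
rewrite ffunE /=; split=> // v vj ve; rewrite (fP _).2 //.
by rewrite vj /sample_index ffunE.
Qed.

End Sampling.

(** * Moments of the samples *)

Section SamplingLaw.
Context (R : realType) (n k B K : nat).
Hypotheses (B_gt0 : (0 < B)%N) (K_gt0 : (0 < K)%N).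

Let card_ord_gt0 m : (0 < m)%N -> (0 < #|'I_m|)%N.
Proof. by rewrite card_ord. Qed.

Definition sample_law : fdist R ('I_B * 'I_K)%type :=
  fdist_prod (unif R (card_ord_gt0 B_gt0)) (unif R (card_ord_gt0 K_gt0)).

Definition sampling_law : fdist R (sampling k B K) :=
  fdist_ffun (fun=> sample_law).

Lemma mean_sample_law (f : 'I_B * 'I_K -> R) :
  mean sample_law f = (\sum_(x < B) (\sum_(r < K) f (x, r)) / K%:R) / B%:R.
Proof.
rewrite mean_prod mean_unif card_ord; congr (_ / _).
by apply: eq_bigr => x _; rewrite mean_unif card_ord.
Qed.

Lemma mean_sampling_law_inj (b : sampling k B K -> sampling k B K)
    (F : sampling k B K -> R) : injective b ->
  mean sampling_law (fun c => F (b c)) = mean sampling_law F.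
Proof.
have uniform c1 c2 : sampling_law c1 = sampling_law c2 by [].
move=> b_inj; rewrite [RHS]/mean (reindex_inj b_inj); apply: eq_bigr => c _.
by rewrite (uniform (b c) c).
Qed.

Hypotheses (nkB : (n <= k * B)%N)
  (dvdK : forall d, (0 < d < n)%N -> (d %| K)%N).
Context (G : sgraph n) (l : 'I_n -> seq 'I_n).
Hypothesis Gl : adj_lists G l.
Implicit Type phi : R -> R.
Local Notation D := (deg_sum R G).

Definition probe_mean phi (j : 'I_k) : R :=
  mean sample_law (fun t => phi (probe_value R G l (j * B + t.1) t.2)).

Lemma mean_cyclic_nbr phi v : phi 0 = 0 ->
  (\sum_(r < K) phi (edge_hmean R G v (cyclic_nbr G l v r))) / K%:R =
  nbr_mean G (fun u => phi (edge_hmean R G v u)) v.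
Proof.
move=> phi0; have [d0|d_gt0] := posnP (deg G v).
  rewrite /nbr_mean /rdeg d0 invr0 mulr0 big1 ?mul0r // => r _.
  by rewrite edge_hmean_isolated.
rewrite (sum_cyclic_nbr (fun u => phi (edge_hmean R G v u)) Gl d_gt0).
  by rewrite mulrAC divff ?mul1r // pnatr_eq0 -lt0n.
by rewrite dvdK // d_gt0 deg_lt.
Qed.

Lemma sum_probe_mean phi : phi 0 = 0 ->
  \sum_j probe_mean phi j =
  (\sum_v nbr_mean G (fun u => phi (edge_hmean R G v u)) v) / B%:R.
Proof.
move=> phi0; under eq_bigr => j _ do rewrite /probe_mean mean_sample_law /=.
rewrite -mulr_suml; congr (_ / _).
rewrite (sum_blocks
  (fun i => (\sum_(r < K) phi (probe_value R G l i r)) / K%:R)).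
rewrite -(sum_extend0 _ nkB); apply: eq_bigr => i _.
rewrite /probe_value /extend0; case: insub => [v|] /=.
  exact: mean_cyclic_nbr.
by rewrite phi0 big1 ?mul0r.
Qed.

Lemma sum_probe_mean_id : \sum_j probe_mean id j = D / B%:R.
Proof. by rewrite sum_probe_mean // sum_nbr_mean_hmean. Qed.

Lemma sum_probe_mean_sqr_le :
  \sum_j probe_mean (fun x => x ^+ 2) j <= D * Num.sqrt D / B%:R.
Proof.
rewrite sum_probe_mean ?expr0n // ler_pM2r ?invr_gt0 ?ltr0n //.
exact: sum_nbr_mean_hmean_sqr_le.
Qed.

(* [x - x^2 / (4 T) <= min x T] reduces the truncation bias to the second
   moment. *)
Lemma sum_probe_mean_min_ge T : 0 < T ->
  D / B%:R - D * Num.sqrt D / B%:R / (4 * T) <=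
  \sum_j probe_mean (Num.min^~ T) j.
Proof.
move=> T0; have inv4T_gt0 : 0 < (4 * T)^-1 by rewrite invr_gt0; lra.
have min_ge x : 0 <= x -> x + - (4 * T)^-1 * x ^+ 2 <= Num.min x T.
  move=> x0; rewrite le_min; apply/andP; split.
    by rewrite gerDl mulNr oppr_le0 mulr_ge0 ?sqr_ge0 // ltW.
  rewrite -subr_ge0.
  have -> : T - (x + - (4 * T)^-1 * x ^+ 2) = (x - 2 * T) ^+ 2 * (4 * T)^-1.
    by field; lra.
  by rewrite mulr_ge0 ?sqr_ge0 // ltW.
apply: (@le_trans _ _ (\sum_j (probe_mean id j
    + - (4 * T)^-1 * probe_mean (fun x => x ^+ 2) j))).
  rewrite big_split /= -mulr_sumr sum_probe_mean_id lerD2l mulNr lerN2 mulrC.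
  by rewrite ler_pM2r // sum_probe_mean_sqr_le.
apply: ler_sum => j _; rewrite -meanZ -meanD; apply: ler_mean => t.
exact/min_ge/probe_value_ge0.
Qed.

Lemma prob_sample_sum_dev_le phi lam : 0 < lam ->
  (forall x, 0 <= x -> 0 <= phi x <= x) ->
  prob sampling_law
    (fun c => lam <= `|sample_sum G l phi c - \sum_j probe_mean phi j|)
  <= D * Num.sqrt D / B%:R / lam ^+ 2.
Proof.
move=> lam0 phi_le; pose F (j : 'I_k) (t : 'I_B * 'I_K) :=
  phi (probe_value R G l (j * B + t.1) t.2).
apply: le_trans (prob_sum_chebyshev (fun=> sample_law) F lam0) _.
rewrite ler_pM2r ?invr_gt0 ?exprn_gt0 //; apply: le_trans sum_probe_mean_sqr_le.
apply: ler_sum => j _; apply: ler_mean => t; rewrite {}/F.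
have value0 := probe_value_ge0 R G l (j * B + t.1) t.2.
have /andP[phi0 phix] := phi_le _ value0.
by rewrite lerXn2r ?nnegrE.
Qed.

End SamplingLaw.

(** * Cyclic noise and geometric grids *)

Section CyclicDistance.
Context (m : nat).
Implicit Types a b z : 'I_m.+1.

Definition cyc_abs z : nat := minn z (m.+1 - z).

Lemma cyc_absD a b : (cyc_abs (a + b)%R <= cyc_abs a + cyc_abs b)%N.
Proof.
rewrite /cyc_abs /=; have := ltn_ord a; have := ltn_ord b.
have [lt_ab|ge_ab] := ltnP (a + b) m.+1; first by rewrite modn_small //; lia.
move=> bm am; have -> : (a + b = 1 * m.+1 + (a + b - m.+1))%N by lia.
by rewrite modnMDl modn_small; lia.
Qed.

Lemma cyc_absN z : cyc_abs (- z)%R = cyc_abs z.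
Proof.
rewrite /cyc_abs /=; have := ltn_ord z.
have [->|z_gt0] := posnP z; first by rewrite subn0 modnn.
by move=> zm; rewrite modn_small; lia.
Qed.

Lemma cyc_abs_inordB x y d : (x <= m)%N -> (y <= m)%N ->
  (x <= y + d)%N -> (y <= x + d)%N -> (cyc_abs (inord x - inord y)%R <= d)%N.
Proof.
wlog xy : x y / (x <= y)%N.
  move=> wlog_xy xm ym xd yd; have [xy|/ltnW yx] := leqP x y.
    exact: wlog_xy.
  by rewrite -cyc_absN opprB wlog_xy.
move=> xm ym _ yd; rewrite -cyc_absN opprB.
suff -> : (inord y - inord x)%R = inord (y - x) :> 'I_m.+1.
  by rewrite /cyc_abs inordK; lia.
apply/eqP; rewrite subr_eq; apply/eqP/val_inj => /=.
by rewrite !inordK ?subnK ?modn_small; lia.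
Qed.

Lemma add_cyc_abs_bounds a z s :
  (s <= a)%N -> (a + s <= m)%N -> (cyc_abs z <= s)%N ->
  (a - s <= (a + z)%R <= a + s)%N.
Proof.
rewrite /cyc_abs /= => sa am; have := ltn_ord z.
have [zs _ _|sz zm zs] := leqP z s; first by rewrite modn_small; lia.
have -> : (a + z = 1 * m.+1 + (a + z - m.+1))%N by lia.
by rewrite modnMDl modn_small; lia.
Qed.

End CyclicDistance.

Section CyclicNoise.
Context (R : realType) (m : nat) (eta : R).
Implicit Types a b z : 'I_m.+1.

Definition noise_weight z : R := expR (- (eta * (cyc_abs z)%:R)).

Definition noise_total : R := \sum_z noise_weight z.

Lemma noise_total_ge1 : 1 <= noise_total.
Proof.
rewrite /noise_total (bigD1 ord0) //= {1}/noise_weight /cyc_abs min0n.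
by rewrite mulr0 oppr0 expR0 lerDl sumr_ge0 // => z _; exact: expR_ge0.
Qed.

Let noise_total_gt0 : 0 < noise_total.
Proof. exact: lt_le_trans noise_total_ge1. Qed.

Let noise_ge0 z : 0 <= noise_weight z / noise_total.
Proof. by rewrite divr_ge0 ?expR_ge0 ?ltW. Qed.

Let noise_sum1 : \sum_z noise_weight z / noise_total = 1.
Proof. by rewrite -mulr_suml divff ?gt_eqF. Qed.

Definition cyclic_noise : fdist R 'I_m.+1 := FDist noise_ge0 noise_sum1.

Hypothesis eta_ge0 : 0 <= eta.

Lemma cyclic_noise_leD a z :
  cyclic_noise z <= expR (eta * (cyc_abs a)%:R) * cyclic_noise (z + a).
Proof.
rewrite /= mulrA ler_pM2r ?invr_gt0 // -expRD ler_expR.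
have : (cyc_abs (z + a))%:R <= (cyc_abs z)%:R + (cyc_abs a)%:R :> R.
  by rewrite -natrD ler_nat cyc_absD.
by move=> /(ler_wpM2l eta_ge0); lra.
Qed.

Lemma cyclic_noise_private a b (S : pred 'I_m.+1) :
  prob cyclic_noise (fun z => S (a + z)) <=
  expR (eta * (cyc_abs (a - b))%:R) * prob cyclic_noise (fun z => S (b + z)).
Proof.
rewrite /prob /mean mulr_sumr [leRHS](reindex_inj (addrI (a - b))) /=.
apply: ler_sum => z _; rewrite [b + _]addrA [b + _]addrCA subrr addr0.
rewrite mulrA ler_wpM2r // [a - b + z]addrC.
exact: cyclic_noise_leD.
Qed.

Lemma cyclic_noise_tail s :
  prob cyclic_noise (fun z => (s < cyc_abs z)%N) <=
  m.+1%:R * expR (- (eta * s%:R)).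
Proof.
rewrite mulr_natl -[X in _ *+ X]card_ord -sumr_const; apply: ler_sum => z _.
case: ltnP => [sz|_] /=; last by rewrite mulr0 expR_ge0.
rewrite mulr1 ler_pdivrMr //; apply: (@le_trans _ _ (expR (- (eta * s%:R)))).
  by rewrite ler_expR lerN2 ler_wpM2l // ler_nat ltnW.
by rewrite ler_peMr ?expR_ge0 // noise_total_ge1.
Qed.

End CyclicNoise.

Section Level.
Context (R : realFieldType) (n : nat) (g : R).
Hypothesis g_ge1 : 1 <= g.
Implicit Type Phi : nat -> R.

Definition level Phi : nat :=
  \max_(a < n.+1 | (g ^+ a) ^+ 2 <= Phi a) a.

Let g_gt0 : 0 < g.
Proof. exact: lt_le_trans g_ge1. Qed.

Lemma level_leq Phi : (level Phi <= n)%N.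
Proof. by apply/bigmax_leqP => a _; rewrite -ltnS. Qed.

Lemma level_ge Phi a : (a <= n)%N -> (g ^+ a) ^+ 2 <= Phi a ->
  (a <= level Phi)%N.
Proof.
rewrite -ltnS => an Pa.
exact: (@leq_bigmax_cond _ (fun b : 'I_n.+1 => (g ^+ b) ^+ 2 <= Phi b)
  (fun b => b : nat) (Ordinal an)).
Qed.

Lemma level_le_bound Phi M : 1 <= M -> (forall a, Phi a <= M) ->
  (g ^+ level Phi) ^+ 2 <= M.
Proof.
move=> M1 PM; apply: (@big_ind _ (fun a => (g ^+ a) ^+ 2 <= M)).
- by rewrite expr0 expr1n.
- by move=> a b; case: (leqP a b).
- by move=> a Pa; exact: le_trans (PM a).
Qed.

(* [Phi1 (a+1) >= g^(2a+2)] gives [Phi1 a >= g^(2a+1) = g^(2a) + (g-1) g^(2a)],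
   and the last term pays for the difference between [Phi1 a] and [Phi2 a]. *)
Lemma level_leS Phi1 Phi2 :
  (forall a, Phi1 a.+1 <= g * Phi1 a) ->
  (forall a, `|Phi1 a - Phi2 a| <= (g - 1) * g ^+ a) ->
  (level Phi1 <= (level Phi2).+1)%N.
Proof.
move=> growth near; apply/bigmax_leqP => -[[|a] an] //= Pa.
rewrite ltnS; apply: level_ge; first exact: ltnW.
have : (g ^+ a) ^+ 2 * g <= Phi1 a.
  have := le_trans Pa (growth a).
  by rewrite [g ^+ a.+1]exprS exprMn expr2 -mulrA ler_pM2l // mulrC.
have : (g - 1) * g ^+ a <= (g - 1) * (g ^+ a) ^+ 2.
  have y1 : 1 <= g ^+ a by exact: exprn_ege1.
  by rewrite ler_wpM2l ?subr_ge0 // expr2 ler_peMr // (le_trans ler01).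
have := near a; rewrite ler_norml => /andP[_]; lra.
Qed.

Lemma exists_level_around X : X < (g ^+ n) ^+ 2 ->
  exists a, [/\ (a <= n)%N, a = 0%N \/ (g ^+ a) ^+ 2 <= X &
                X < (g ^+ a.+1) ^+ 2].
Proof.
move=> Xg; pose below a := (a == 0%N) || ((g ^+ a) ^+ 2 <= X).
have below0 : exists a, below a by exists 0%N.
have below_le a : below a -> (a <= n)%N.
  move=> /orP[/eqP -> //|aX]; rewrite leqNgt; apply/negP => na.
  have := le_lt_trans aX Xg; apply/negP; rewrite -leNgt -!exprM.
  by rewrite ler_weXn2l // leq_mul2r ltnW.
case: (ex_maxnP below0 below_le) => a below_a a_max; exists a; split.
- exact: below_le.
- by case/orP: below_a => [/eqP|]; [left|right].
- rewrite ltNge; apply/negP => aX; have /a_max : below a.+1.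
    by rewrite /below aX orbT.
  by rewrite ltnn.
Qed.

End Level.

(** * The algorithm *)

Lemma relative_error_le (R : realFieldType) (rho x y u v e : R) :
  0 < rho <= 2^-1 -> 0 <= x -> 0 <= y -> 0 <= e <= 1 + rho / 4 ->
  u <= (1 + rho / 4) * x -> (1 - rho / 4) * x <= v ->
  y <= u * e -> v <= y * e ->
  (1 - rho) * x <= y <= (1 + rho) * x.
Proof.
move=> /andP[rho0 rho1] x0 y0 /andP[e0 e1] ux xv yue vye.
have factor_gt0 : 0 < 1 + rho / 4 by lra.
have rhox : 0 <= rho * x by rewrite mulr_ge0 // ltW.
have rho2x : 0 <= rho * x * (2^-1 - rho) by rewrite mulr_ge0 //; lra.
apply/andP; split.
  have := ler_wpM2l y0 e1; rewrite -(ler_pM2r factor_gt0); nra.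
have := ler_wpM2r e0 ux.
have := ler_wpM2l x0 (ler_wpM2l (ltW factor_gt0) e1); lra.
Qed.

Section Algorithm.
Context (R : realType) (n k B K : nat) (tau eta : R).
Hypotheses (B_gt0 : (0 < B)%N) (K_gt0 : (0 < K)%N) (nkB : (n <= k * B)%N)
  (dvdK : forall d, (0 < d < n)%N -> (d %| K)%N)
  (tau_gt0 : 0 < tau) (eta_ge0 : 0 <= eta).
Implicit Types (G : sgraph n) (l : 'I_n -> seq 'I_n) (c : sampling k B K).

(* With this ratio an edge changes the estimate truncated at [cap a] by at most
   [(grid_ratio - 1) * grid_ratio ^+ a]. *)
Definition grid_ratio : R := 1 + 4 * B%:R * tau / n%:R.
Local Notation g := grid_ratio.

Lemma grid_ratio_ge1 : 1 <= g.
Proof. by rewrite lerDl divr_ge0 ?mulr_ge0 // ltW. Qed.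

Let gX_gt0 a : 0 < g ^+ a.
Proof. by rewrite exprn_gt0 // (lt_le_trans ltr01) ?grid_ratio_ge1. Qed.

Definition cap (a : nat) : R := tau * g ^+ a.

Lemma cap_gt0 a : 0 < cap a.
Proof. exact: mulr_gt0. Qed.

(* The levels range over [0, n]; shifting them by [n] in a group of order
   [3n + 1] keeps noise of size at most [n] from wrapping around. *)
Definition noise_range := (3 * n)%N.

Definition shift (a : nat) : 'I_noise_range.+1 := inord (a + n).

Definition decode (i : 'I_noise_range.+1) : R := (g ^+ i / g ^+ n) ^+ 2.

Lemma add_shift_bounds x s (z : 'I_noise_range.+1) :
  (x <= n)%N -> (s <= n)%N -> (cyc_abs z <= s)%N ->
  (x + n - s <= (shift x + z)%R <= x + n + s)%N.
Proof.
move=> xn sn zs.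
have <- : shift x = (x + n)%N :> nat by rewrite inordK // /noise_range; lia.
by apply: add_cyc_abs_bounds => //; rewrite inordK /noise_range; lia.
Qed.

Lemma decode_bounds x s (z : 'I_noise_range.+1) :
  (x <= n)%N -> (s <= n)%N -> (cyc_abs z <= s)%N ->
  decode (shift x + z) <= (g ^+ x) ^+ 2 * (g ^+ s.+1) ^+ 2 /\
  (g ^+ x.+1) ^+ 2 <= decode (shift x + z) * (g ^+ s.+1) ^+ 2.
Proof.
move=> xn sn zs; have g_ge1 := grid_ratio_ge1.
have := add_shift_bounds xn sn zs; rewrite /decode.
move: (shift x + z) => i /andP[i_ge i_le].
have quot_le : g ^+ i / g ^+ n <= g ^+ x * g ^+ s.+1.
  by rewrite ler_pdivrMr // -!exprD ler_weXn2l //; lia.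
have quot_ge : g ^+ x.+1 <= g ^+ i / g ^+ n * g ^+ s.+1.
  by rewrite mulrAC ler_pdivlMr // -!exprD ler_weXn2l //; lia.
have gX_ge0 a : 0 <= g ^+ a by exact: ltW.
by rewrite -!exprMn; split; rewrite lerXn2r ?nnegrE ?mulr_ge0 ?invr_ge0.
Qed.

Definition scaled_sum (xs : seq R) (a : nat) : R :=
  B%:R / n%:R * \sum_(x <- xs) Num.min x (cap a).

Definition alg_tree (w : sampling k B K * 'I_noise_range.+1) : qtree R n :=
  qbind (qseq [seq probe R n (sample_index w.1 j) (w.1 j).2 | j <- enum 'I_k])
    (fun xs => Output n (decode (shift (level n g (scaled_sum xs)) + w.2))).

Definition alg : rand_alg R n :=
  finite_alg (fdist_prod (sampling_law R k B_gt0 K_gt0)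
                         (cyclic_noise noise_range eta)) alg_tree.

Definition estimate G l c (a : nat) : R :=
  B%:R / n%:R * sample_sum G l (Num.min^~ (cap a)) c.

Definition sample_level G l c : nat := level n g (estimate G l c).

Lemma sample_level_leq G l c : (sample_level G l c <= n)%N.
Proof. exact: level_leq. Qed.

Lemma result_alg_tree G l w : adj_lists G l ->
  result G l (alg_tree w) = decode (shift (sample_level G l w.1) + w.2).
Proof.
move=> Gl; rewrite /alg_tree result_bind result_seq -map_comp /=.
congr (decode (shift (level _ _ _) + _)); apply/funext => a.
rewrite /scaled_sum big_map big_enum; congr (_ * _).
by apply: eq_bigr => j _; rewrite /= result_probe.
Qed.

Lemma runs_within_alg : runs_within alg (3 * k)%:R.
Proof.
move=> L _ G w; rewrite ler_nat nqueries_bind /= addn0 nqueries_seq -map_comp.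
rewrite sumnE big_map big_enum mulnC -[X in (X * 3)%N]card_ord -sum_nat_const.
by apply: leq_sum => j _; exact: nqueries_probe_le3.
Qed.

Lemma out_prob_alg L G (S : set R) : numbering L ->
  out_prob alg L G S = (mean (sampling_law R k B_gt0 K_gt0) (fun c =>
    prob (cyclic_noise noise_range eta)
      (fun z => decode (shift (sample_level G (L G) c) + z) \in S)))%:E.
Proof.
move=> LP; rewrite out_prob_finite_alg [prob _ _]mean_prod; congr EFin.
by apply: eq_mean => c; apply: eq_mean => z; rewrite result_alg_tree.
Qed.

Lemma estimateS G l c a : estimate G l c a.+1 <= g * estimate G l c a.
Proof.
rewrite [leRHS]mulrCA ler_wpM2l ?divr_ge0 // mulr_sumr.
have g0 : 0 <= g by exact: le_trans grid_ratio_ge1.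
apply: ler_sum => j _; rewrite minr_pMr // /cap exprS [tau * _]mulrCA.
by rewrite le_min2 // ler_peMl ?probe_value_ge0 ?grid_ratio_ge1.
Qed.

Lemma sample_level_leS G1 G2 l1 l2 c1 c2 :
  (forall T : R, 0 <= T -> `|sample_sum G1 l1 (Num.min^~ T) c1
                             - sample_sum G2 l2 (Num.min^~ T) c2| <= 4 * T) ->
  (sample_level G1 l1 c1 <= (sample_level G2 l2 c2).+1)%N.
Proof.
move=> near; apply: level_leS => [|a|a]; first exact: grid_ratio_ge1.
  exact: estimateS.
have scale_ge0 : 0 <= B%:R / n%:R :> R by rewrite divr_ge0.
rewrite -mulrBr normrM ger0_norm //.
apply: le_trans (ler_wpM2l scale_ge0 (near _ (ltW (cap_gt0 a)))) _.
rewrite (_ : _ * (4 * cap a) = (g - 1) * g ^+ a) //.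
by rewrite /cap /grid_ratio; ring.
Qed.

Lemma edge_dp_alg : edge_dp eta alg.
Proof.
move=> L LP G1 G2 [e card_e agree_off_e] S _.
rewrite !out_prob_alg // -EFinM lee_fin.
have [f f_inj f_coupled] :=
  exists_coupling k B dvdK (LP G1) (LP G2) agree_off_e.
rewrite -meanZ -[leLHS](mean_sampling_law_inj _ _ _ (relabel_inj f_inj)).
apply: ler_mean => c.
have near (T : R) (T0 : 0 <= T) :=
  dist_sample_sum_le nkB (LP G1) (LP G2) card_e T0 agree_off_e (f_coupled c).
have level12 := sample_level_leS near.
have level21 : (sample_level G2 (L G2) c <=
    (sample_level G1 (L G1) (relabel f c)).+1)%N.
  by apply: sample_level_leS => T T0; rewrite distrC near.
apply: le_trans (cyclic_noise_private eta_ge0 _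
  (shift (sample_level G2 (L G2) c)) (fun i => decode i \in S)) _.
rewrite ler_wpM2r ?prob_ge0 // ler_expR ler_piMr // lern1.
have le1n := sample_level_leq G1 (L G1) (relabel f c).
have le2n := sample_level_leq G2 (L G2) c.
by apply: cyc_abs_inordB; rewrite /noise_range; lia.
Qed.

Section Accuracy.
Context (L : sgraph n -> 'I_n -> seq 'I_n) (G : sgraph n) (rho : R).
Hypotheses (LP : numbering L) (rho_gt0 : 0 < rho) (rho_le : rho <= 2^-1)
  (avg_ge1 : 1 <= avg_degree R G).
Local Notation l := (L G).
Local Notation D := (deg_sum R G).
Local Notation d := (avg_degree R G).

Let Gl : adj_lists G l := LP G.
Let n_gt0 : (0 < n)%N.
Proof.
rewrite lt0n; apply: contraTneq avg_ge1 => n0.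
have nR0 : n%:R = 0 :> R by rewrite n0.
by rewrite avg_degreeE nR0 invr0 mulr0 -ltNge.
Qed.

Let n_gt0R : 0 < n%:R :> R. Proof. by rewrite ltr0n. Qed.
Let B_gt0R : 0 < B%:R :> R. Proof. by rewrite ltr0n. Qed.

Lemma deg_sum_ge_n : n%:R <= D.
Proof. by move: avg_ge1; rewrite avg_degreeE ler_pdivlMr // mul1r. Qed.

Let D_gt0 : 0 < D. Proof. exact: lt_le_trans deg_sum_ge_n. Qed.

Lemma block_rescale x : B%:R / n%:R * (x * (D / B%:R)) = x * d.
Proof. by rewrite avg_degreeE; field; rewrite !gt_eqF. Qed.

Local Notation tolerance := (rho / 8 * (D / B%:R)).

Let tolerance_gt0 : 0 < tolerance.
Proof. by rewrite !mulr_gt0 ?invr_gt0. Qed.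

Definition deviates (phi : R -> R) : pred (sampling k B K) := fun c =>
  tolerance <=
  `|sample_sum G l phi c - \sum_(j < k) probe_mean B_gt0 K_gt0 G l phi j|.

Lemma prob_deviates_le phi : (forall x, 0 <= x -> 0 <= phi x <= x) ->
  prob (sampling_law R k B_gt0 K_gt0) (deviates phi) <=
  64 * B%:R / (rho ^+ 2 * Num.sqrt n%:R).
Proof.
move=> phi_le.
apply: le_trans (prob_sample_sum_dev_le B_gt0 K_gt0 nkB dvdK Gl _ _) _ => //.
have sqrtD_gt0 : 0 < Num.sqrt D by rewrite sqrtr_gt0.
have sqrtn_gt0 : 0 < Num.sqrt n%:R :> R by rewrite sqrtr_gt0.
have -> : D * Num.sqrt D / B%:R / tolerance ^+ 2 =
    64 * B%:R / (rho ^+ 2 * Num.sqrt D).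
  rewrite -{1 3}(sqr_sqrtr (deg_sum_ge0 R G)).
  by move: (Num.sqrt D) sqrtD_gt0 => s s_gt0; field; rewrite !gt_eqF.
rewrite ler_pM2l ?mulr_gt0 // lef_pV2 ?posrE ?mulr_gt0 ?exprn_gt0 //.
by rewrite ler_pM2l ?exprn_gt0 // ler_wsqrtr // deg_sum_ge_n.
Qed.

Lemma sample_level_upper c : ~~ deviates id c ->
  (g ^+ sample_level G l c) ^+ 2 <= (1 + rho / 4) * d.
Proof.
rewrite /deviates -ltNge (sum_probe_mean_id R B_gt0 K_gt0 nkB dvdK Gl).
rewrite ltr_norml => /andP[_ dev]; apply: level_le_bound => [|a].
  by rewrite mulr_ege1 // lerDl divr_ge0 // ltW.
apply: (@le_trans _ _ (B%:R / n%:R * ((1 + rho / 4) * (D / B%:R)))); last first.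
  by rewrite block_rescale.
rewrite ler_pM2l ?divr_gt0 //; apply: (@le_trans _ _ (sample_sum G l id c)).
  by apply: ler_sum => j _; rewrite ge_min lexx.
by move: dev tolerance_gt0; lra.
Qed.

Lemma sample_level_lower c a :
  (a <= n)%N -> 2 * Num.sqrt D <= rho * cap a ->
  ~~ deviates (Num.min^~ (cap a)) c ->
  (g ^+ a) ^+ 2 <= (1 - rho / 4) * d -> (a <= sample_level G l c)%N.
Proof.
move=> an cap_large dev ga; apply: level_ge an _; apply: le_trans ga _.
rewrite -block_rescale ler_pM2l ?divr_gt0 //.
have bias : D * Num.sqrt D / B%:R / (4 * cap a) <= tolerance.
  rewrite ler_pdivrMr ?mulr_gt0 ?cap_gt0 //.
  rewrite [D * Num.sqrt D / _]mulrAC [leLHS]mulrC.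
  have -> : tolerance * (4 * cap a) = rho * cap a / 2 * (D / B%:R).
    by field; rewrite gt_eqF.
  by rewrite ler_pM2r ?divr_gt0 //; lra.
have mean_ge := sum_probe_mean_min_ge B_gt0 K_gt0 nkB dvdK Gl (cap_gt0 a).
by move: dev mean_ge bias; rewrite /deviates -ltNge ltr_norml => /andP[]; lra.
Qed.

Hypotheses (tau_large : 32 * n%:R <= rho ^+ 2 * tau ^+ 2) (ratio_le2 : g <= 2).

Lemma sqrt_deg_sum_le_cap a : (1 - rho / 4) * d < (g ^+ a.+1) ^+ 2 ->
  2 * Num.sqrt D <= rho * cap a.
Proof.
move=> below.
have sqrtD_ge0 : 0 <= 2 * Num.sqrt D by rewrite mulr_ge0 ?sqrtr_ge0.
have rho_cap_ge0 : 0 <= rho * cap a by rewrite mulr_ge0 ?ltW ?cap_gt0.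
rewrite -(@ler_pXn2r _ 2) ?nnegrE // /cap !exprMn sqr_sqrtr ?deg_sum_ge0 //.
rewrite -natrX mulrA.
have gX_sqr_ge0 : 0 <= (g ^+ a) ^+ 2 by exact: sqr_ge0.
have g_sqr_le4 : g ^+ 2 <= 2 ^+ 2.
  by rewrite lerXn2r ?nnegrE // (le_trans ler01) ?grid_ratio_ge1.
have d_le : d <= 8 * (g ^+ a) ^+ 2.
  have := ler_wpM2r gX_sqr_ge0 g_sqr_le4.
  move: below; rewrite [g ^+ a.+1]exprS exprMn.
  have d_ge0 : 0 <= d by exact: le_trans avg_ge1.
  have : 0 <= d * (2^-1 - rho) by rewrite mulr_ge0 // subr_ge0.
  lra.
apply: le_trans (ler_wpM2r gX_sqr_ge0 tau_large).
by move: d_le; rewrite avg_degreeE ler_pdivrMr //; lra.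
Qed.

Lemma exists_cap_sample_level : n%:R <= (g ^+ n) ^+ 2 -> exists a,
  forall c, ~~ deviates id c -> ~~ deviates (Num.min^~ (cap a)) c ->
    (g ^+ sample_level G l c) ^+ 2 <= (1 + rho / 4) * d /\
    (1 - rho / 4) * d <= (g ^+ (sample_level G l c).+1) ^+ 2.
Proof.
move=> n_le_g; have g_ge1 := grid_ratio_ge1.
have below_n : (1 - rho / 4) * d < (g ^+ n) ^+ 2.
  apply: lt_le_trans n_le_g; apply: le_lt_trans (avg_degree_lt R G n_gt0).
  by rewrite ler_piMl ?(le_trans ler01) // gerBl divr_ge0 // ltW.
have [a [an a_le a_gt]] := exists_level_around g_ge1 below_n.
exists a => c dev_id dev_cap; split; first exact: sample_level_upper.
apply: ltW; apply: (lt_le_trans a_gt).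
rewrite lerXn2r ?nnegrE ?(ltW (gX_gt0 _)) // ler_weXn2l // ltnS.
case: a_le => [-> //|].
exact: sample_level_lower an (sqrt_deg_sum_le_cap a_gt) dev_cap.
Qed.

Lemma decode_accurate x s (z : 'I_noise_range.+1) :
  (x <= n)%N -> (s <= n)%N -> (cyc_abs z <= s)%N ->
  (g ^+ s.+1) ^+ 2 <= 1 + rho / 4 ->
  (g ^+ x) ^+ 2 <= (1 + rho / 4) * d ->
  (1 - rho / 4) * d <= (g ^+ x.+1) ^+ 2 ->
  (1 - rho) * d <= decode (shift x + z) <= (1 + rho) * d.
Proof.
move=> xn sn zs gs upper lower; have [dec_le dec_ge] := decode_bounds xn sn zs.
apply: relative_error_le upper lower dec_le dec_ge.
- by rewrite rho_gt0.
- exact: le_trans avg_ge1.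
- exact: sqr_ge0.
- by rewrite sqr_ge0.
Qed.

Lemma out_prob_alg_accurate s (S : set R) :
  n%:R <= (g ^+ n) ^+ 2 -> (s <= n)%N ->
  (g ^+ s.+1) ^+ 2 <= 1 + rho / 4 ->
  [set x | (1 - rho) * d <= x <= (1 + rho) * d] `<=` S ->
  ((1 - (128 * B%:R / (rho ^+ 2 * Num.sqrt n%:R)
     + noise_range.+1%:R * expR (- (eta * s%:R))))%:E <=
   out_prob alg L G S)%E.
Proof.
move=> n_le_g sn gs S_good; have [a level_ok] := exists_cap_sample_level n_le_g.
rewrite out_prob_finite_alg lee_fin; set P := fdist_prod _ _.
pose bad := predU
  (predU (fun w => deviates id w.1)
         (fun w => deviates (Num.min^~ (cap a)) w.1))
  (fun w : sampling k B K * 'I_noise_range.+1 => s < cyc_abs w.2)%N.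
apply: le_trans (prob_ge_compl P (B := bad) _); last first.
  move=> w; rewrite !inE !negb_or -leqNgt.
  move=> /andP[/andP[sum_ok capped_ok] noise_ok].
  rewrite result_alg_tree //; apply: S_good => /=.
  have [upper lower] := level_ok w.1 sum_ok capped_ok.
  exact: (decode_accurate (sample_level_leq _ _ _) sn noise_ok gs upper lower).
rewrite lerB //; apply: le_trans (prob_predU_le _ _ _) _.
apply: lerD; last first.
  rewrite [leLHS](prob_snd _ _ (fun z => s < cyc_abs z)%N).
  exact: cyclic_noise_tail.
have -> : 128 * B%:R / (rho ^+ 2 * Num.sqrt n%:R) =
    64 * B%:R / (rho ^+ 2 * Num.sqrt n%:R)
    + 64 * B%:R / (rho ^+ 2 * Num.sqrt n%:R) by ring.
apply: le_trans (prob_predU_le _ _ _) _.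
apply: lerD; rewrite [leLHS](prob_fst _ _ (deviates _)).
all: apply: prob_deviates_le.
- by move=> x x0; rewrite /= x0 lexx.
- by move=> x x0; rewrite le_min x0 ltW ?cap_gt0 ?ge_min ?lexx.
Qed.

End Accuracy.
End Algorithm.

(** * Choice of the parameters *)

Section Inequalities.
Context (R : realType).
Implicit Type x : R.

Lemma bernoulli_inequality x n : 0 <= x -> 1 + n%:R * x <= (1 + x) ^+ n.
Proof.
move=> x0; elim: n => [|n IH]; first by rewrite mul0r addr0 expr0.
have := ler_wpM2l (addr_ge0 ler01 x0) IH; rewrite -exprS -natr1.
have : 0 <= n%:R * x * x by rewrite !mulr_ge0.
lra.
Qed.

Lemma expr1D_le_expR x n : 0 <= x -> (1 + x) ^+ n <= expR (n%:R * x).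
Proof.
move=> x0; rewrite expRM_natl lerXn2r ?nnegrE ?expR_ge0 ?addr_ge0 //.
exact: expR_ge1Dx.
Qed.

Lemma expR_le1D2x x : 0 <= x <= 2^-1 -> expR x <= 1 + 2 * x.
Proof.
move=> /andP[x0 x1]; rewrite -[x]opprK expRN -[leRHS]mul1r opprK.
rewrite -[leLHS]mul1r ler_pdivrMr ?expR_gt0 // mul1r.
have := expR_ge1Dx (- x); have : 0 <= x * (1 - 2 * x) by rewrite mulr_ge0; lra.
have : 0 <= 1 + 2 * x by lra.
by nra.
Qed.

Lemma sqrt_expR x : Num.sqrt (expR x) = expR (x / 2).
Proof.
have -> : expR x = expR (x / 2) ^+ 2.
  by rewrite -expRM_natl; congr expR; field.
by rewrite sqrtr_sqr ger0_norm ?expR_ge0.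
Qed.

Lemma expr4_le_expR x : 256 <= x -> x ^+ 4 <= expR (x / 2).
Proof.
move=> x_large; have -> : expR (x / 2) = (expR (x / 16) ^+ 2) ^+ 4.
  by rewrite -exprM -expRM_natl; congr expR; field.
rewrite lerXn2r ?nnegrE ?exprn_ge0 ?expR_ge0 //; first lra.
apply: (@le_trans _ _ ((x / 16) ^+ 2)); first by rewrite expr2; nra.
rewrite lerXn2r ?nnegrE ?expR_ge0 //; first lra.
by apply: le_trans (expR_ge1Dx _); lra.
Qed.

Lemma near_ln_ge (M : R) : \forall n \near \oo, M <= ln n%:R.
Proof.
near=> n; have exp_le : expR M <= n%:R by near: n; exact: nbhs_infty_ger.
rewrite -[M]expRK ler_ln ?posrE ?expR_gt0 //.
exact: lt_le_trans (expR_gt0 M) exp_le.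
Unshelve. all: by end_near.
Qed.

End Inequalities.

Section ParameterChoice.
Context (R : realType) (n : nat).
Local Notation ell := (ln n%:R : R).
Local Notation r := (Num.sqrt n%:R : R).

Definition block_size : nat := Num.truncn (r / ell ^+ 4).
Definition block_count : nat := (n %/ block_size).+1.
Definition cap_scale : R := ell * r.
Definition noise_bound : nat := (Num.truncn (2 * ell ^+ 2)).+1.

Local Notation B := block_size.
Local Notation k := block_count.
Local Notation tau := cap_scale.
Local Notation s := noise_bound.
Local Notation g := (grid_ratio n B tau).

Hypothesis ell_ge : 800 <= ell.

Let ell_gt0 : 0 < ell. Proof. by have := ell_ge; lra. Qed.

Let ell4_gt0 : 0 < ell ^+ 4. Proof. by rewrite exprn_gt0. Qed.

Let n_gt0 : (0 < n)%N.
Proof. by case: n ell_gt0 => //; rewrite ln0 // ltxx. Qed.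

Let nE : n%:R = expR ell.
Proof. by rewrite lnK // posrE ltr0n n_gt0. Qed.

Let r_gt0 : 0 < r. Proof. by rewrite sqrtr_gt0 ltr0n n_gt0. Qed.

Let r_sqr : n%:R = r ^+ 2. Proof. by rewrite sqr_sqrtr. Qed.

Lemma ln_expr4_le_sqrt : ell ^+ 4 <= r.
Proof.
by rewrite nE sqrt_expR expRK expr4_le_expR //; have := ell_ge; lra.
Qed.

Let quot_ge1 : 1 <= r / ell ^+ 4.
Proof. by rewrite ler_pdivlMr // mul1r ln_expr4_le_sqrt. Qed.

Lemma block_size_gt0 : (0 < B)%N.
Proof. by rewrite truncn_gt0 quot_ge1. Qed.

Let B_gt0 : 0 < B%:R :> R. Proof. by rewrite ltr0n block_size_gt0. Qed.

Lemma block_size_le : B%:R * ell ^+ 4 <= r.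
Proof. by rewrite -ler_pdivlMr // truncn_le (le_trans ler01). Qed.

Lemma block_size_ge : r <= 2 * (B%:R * ell ^+ 4).
Proof.
rewrite mulrA -ler_pdivrMr //; have := truncnS_gt (r / ell ^+ 4).
have : 1 <= B%:R :> R by rewrite ler1n block_size_gt0.
by rewrite -/B -natr1; lra.
Qed.

Lemma leq_blocks : (n <= k * B)%N.
Proof. exact/ltnW/ltn_ceil/block_size_gt0. Qed.

Lemma block_count_le : (3 * k)%:R <= 9 * r * ell ^+ 4.
Proof.
have quot_le : (n %/ B)%:R <= 2 * (r * ell ^+ 4).
  apply: (@le_trans _ _ (n%:R / B%:R)).
    by rewrite ler_pdivlMr // -natrM ler_nat leq_divM.
  rewrite ler_pdivrMr // {1}r_sqr expr2.
  have -> : 2 * (r * ell ^+ 4) * B%:R = r * (2 * (B%:R * ell ^+ 4)) by ring.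
  by rewrite ler_pM2l // block_size_ge.
have : 1 <= r * ell ^+ 4.
  have ell4_ge1 : 1 <= ell ^+ 4 by apply: exprn_ege1; have := ell_ge; lra.
  by rewrite mulr_ege1 // (le_trans ell4_ge1) // ln_expr4_le_sqrt.
by rewrite natrM -[k%:R]natr1 -(mulrA 9); lra.
Qed.

Lemma cap_scale_gt0 : 0 < tau.
Proof. exact: mulr_gt0. Qed.

Lemma grid_ratioE : g = 1 + 4 * B%:R * ell / r.
Proof.
rewrite /grid_ratio /cap_scale; congr (1 + _); rewrite [X in _ / X = _]r_sqr.
by field; rewrite gt_eqF.
Qed.

Local Notation step := (4 * B%:R * ell / r).

Let step_ge0 : 0 <= step.
Proof. by rewrite divr_ge0 ?mulr_ge0 // ltW. Qed.

Let step_ell3_le : step * ell ^+ 3 <= 4.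
Proof.
rewrite mulrAC ler_pdivrMr // -(mulrA _ ell) -exprS -mulrA.
by rewrite ler_pM2l // block_size_le.
Qed.

Lemma grid_ratio_le2 : g <= 2.
Proof.
have ell3_ge4 : 4 <= ell ^+ 3.
  rewrite -[leLHS]mul1r exprSr ler_pM //; last by have := ell_ge; lra.
  by apply: exprn_ege1; have := ell_ge; lra.
rewrite grid_ratioE; have := step_ge0; have := step_ell3_le.
by move: step => st st_ell3 st0; nra.
Qed.

Lemma grid_top_ge : n%:R <= (g ^+ n) ^+ 2.
Proof.
rewrite {1}r_sqr grid_ratioE.
rewrite lerXn2r ?nnegrE ?exprn_ge0 ?addr_ge0 ?(ltW r_gt0) //.
apply: le_trans (bernoulli_inequality n step_ge0).
have -> : n%:R * step = 4 * (B%:R * ell) * r.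
  by rewrite {1}r_sqr; field; rewrite gt_eqF.
have : 1 <= B%:R * ell.
  by rewrite mulr_ege1 ?ler1n ?block_size_gt0 //; have := ell_ge; lra.
by have := r_gt0; nra.
Qed.

Let noise_bound_ge : 2 * ell ^+ 2 <= s%:R.
Proof. exact/ltW/truncnS_gt. Qed.

Let noise_bound_le : s%:R <= 2 * ell ^+ 2 + 1.
Proof. by rewrite /noise_bound -natr1 lerD2r truncn_le mulr_ge0 ?sqr_ge0. Qed.

Lemma noise_bound_leq : (s <= n)%N.
Proof.
rewrite -(ler_nat R); apply: (le_trans noise_bound_le).
have ell2_ge3 : 3 <= ell ^+ 2 by have := ell_ge; rewrite expr2; nra.
have ell4_ge : 3 * ell ^+ 2 <= ell ^+ 4.
  by rewrite (exprD _ 2 2) ler_wpM2r ?sqr_ge0.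
have r_ge1 : 1 <= r by have := ln_expr4_le_sqrt; lra.
have : r <= n%:R by rewrite [leRHS]r_sqr expr2 ler_peMr // ltW.
by have := ln_expr4_le_sqrt; lra.
Qed.

Context (rho eps : R).
Hypotheses (rho_gt0 : 0 < rho) (rho_le : rho <= 2^-1)
  (rho_ell : 400 <= rho * ell) (eps_ge : ell^-1 <= eps).

Lemma grid_noise_le : (g ^+ s.+1) ^+ 2 <= 1 + rho / 4.
Proof.
rewrite -exprM grid_ratioE; apply: le_trans (expr1D_le_expR _ step_ge0) _.
have exponent_le : (s.+1 * 2)%:R * step <= rho / 16.
  have s_le : (s.+1 * 2)%:R <= 5 * ell ^+ 2.
    have : 4 <= ell ^+ 2 by have := ell_ge; rewrite expr2; nra.
    by have := noise_bound_le; rewrite natrM -natr1; lra.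
  apply: (le_trans (ler_wpM2r step_ge0 s_le)); rewrite -(ler_pM2r ell_gt0).
  have -> : 5 * ell ^+ 2 * step * ell = 5 * (step * ell ^+ 3) by ring.
  by have := step_ell3_le; have := rho_ell; lra.
have exponent_ge0 : 0 <= (s.+1 * 2)%:R * step by rewrite mulr_ge0.
have rho1 := rho_le; have rho0 := rho_gt0.
apply: le_trans (expR_le1D2x _) _; last lra.
by apply/andP; split => //; lra.
Qed.

Lemma cap_scale_large : 32 * n%:R <= rho ^+ 2 * tau ^+ 2.
Proof.
rewrite /cap_scale exprMn -r_sqr mulrA ler_wpM2r // -exprMn expr2.
by have := rho_ell; nra.
Qed.

Lemma sampling_failure_le : 128 * B%:R / (rho ^+ 2 * r) <= 1 / ell.
Proof.
have rho2_ell3 : 128 <= rho ^+ 2 * ell ^+ 3.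
  have -> : rho ^+ 2 * ell ^+ 3 = (rho * ell) ^+ 2 * ell by ring.
  have : 1 <= (rho * ell) ^+ 2 by apply: exprn_ege1; have := rho_ell; lra.
  by have := ell_ge; nra.
rewrite ler_pdivrMr ?mulr_gt0 ?exprn_gt0 // mulrAC ler_pdivlMr // mul1r.
apply: (@le_trans _ _ (rho ^+ 2 * (B%:R * ell ^+ 4))); last first.
  by rewrite ler_pM2l ?exprn_gt0 // block_size_le.
have -> : rho ^+ 2 * (B%:R * ell ^+ 4) = rho ^+ 2 * ell ^+ 3 * (B%:R * ell).
  by ring.
by rewrite -(mulrA 128) ler_wpM2r // mulr_ge0 // ltW.
Qed.

Lemma noise_failure_le :
  (noise_range n).+1%:R * expR (- (eps * s%:R)) <= 4 / ell.
Proof.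
have eps_s : 2 * ell <= eps * s%:R.
  have -> : 2 * ell = ell^-1 * (2 * ell ^+ 2) by field; rewrite gt_eqF.
  by rewrite ler_pM ?invr_ge0 ?mulr_ge0 ?sqr_ge0 // ltW.
apply: (@le_trans _ _ ((noise_range n).+1%:R * expR (- (2 * ell)))).
  by rewrite ler_wpM2l // ler_expR lerN2.
have n_ge1 : 1 <= n%:R :> R by rewrite ler1n n_gt0.
have ell_le_n : ell <= n%:R.
  by rewrite [leRHS]nE; apply: le_trans (expR_ge1Dx _); lra.
rewrite expRN expRM_natl -nE ler_pdivrMr ?exprn_gt0 ?ltr0n ?n_gt0 //.
rewrite -natr1 /noise_range natrM mulrAC ler_pdivlMr // expr2.
by have := ler_wpM2l (ler0n R n) ell_le_n; nra.
Qed.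

Lemma exists_accurate_alg : exists A : rand_alg R n,
  [/\ edge_dp eps A, runs_within A (9 * r * ell ^+ 4) &
      forall L G (S : set R), numbering L -> 1 <= avg_degree R G ->
      [set x | (1 - rho) * avg_degree R G <= x <= (1 + rho) * avg_degree R G]%R
        `<=` S ->
      ((1 - 5 / ell)%:E <= out_prob A L G S)%E].
Proof.
have eps_ge0 : 0 <= eps by apply: le_trans eps_ge; rewrite invr_ge0 ltW.
(* With [K = n`!] the neighbor number [r %% deg v], for [r < K] uniform, is
   uniform. *)
have dvd_fact d : (0 < d < n)%N -> (d %| n`!)%N.
  by move=> /andP[d0 dn]; rewrite dvdn_fact // d0 ltnW.
exists (alg n k tau eps block_size_gt0 (fact_gt0 n)); split.
- exact: edge_dp_alg leq_blocks dvd_fact cap_scale_gt0 eps_ge0.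
- move=> L LP G w; apply: le_trans block_count_le.
  exact: (runs_within_alg LP).
- move=> L G S LP avg_ge1 S_good.
  apply: le_trans (out_prob_alg_accurate block_size_gt0 (fact_gt0 n) leq_blocks
    dvd_fact cap_scale_gt0 eps_ge0 LP rho_gt0 rho_le avg_ge1 cap_scale_large
    grid_ratio_le2 grid_top_ge noise_bound_leq grid_noise_le S_good).
  rewrite lee_fin lerB // (_ : 5 / ell = 1 / ell + 4 / ell); last by ring.
  by rewrite lerD ?sampling_failure_le ?noise_failure_le.
Qed.

End ParameterChoice.

Section Assembly.
Context (R : realType).
Implicit Types (rho : R) (n : nat).

Definition const_alg n (x : R) : rand_alg R n :=
  finite_alg (unif R (T := unit) (eq_leq (esym card_unit)))
    (fun=> Output n x).

Lemma edge_dp_const_alg n (x eps : R) : 0 <= eps -> edge_dp eps (const_alg n x).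
Proof.
move=> eps0 L LP G1 G2 _ S _; rewrite !out_prob_finite_alg -EFinM lee_fin.
by rewrite ler_peMl ?prob_ge0 // -expR0 ler_expR.
Qed.

Definition clipped rho : R := Num.min rho 2^-1.

Lemma clipped_gt0 rho : 0 < rho -> 0 < clipped rho.
Proof. by move=> rho0; rewrite lt_min rho0 invr_gt0 ltr0n. Qed.

Lemma clipped_le rho : clipped rho <= rho.
Proof. by rewrite ge_min lexx. Qed.

Lemma clipped_le_half rho : clipped rho <= 2^-1.
Proof. by rewrite ge_min lexx orbT. Qed.

Definition large_enough rho (eps : R) n : Prop :=
  [/\ 400 <= clipped rho * ln n%:R, (ln n%:R)^-1 <= eps & rho ^+ 2 <= ln n%:R].

Lemma large_ln_ge rho eps n :
  0 < rho -> large_enough rho eps n -> 800 <= ln n%:R :> R.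
Proof.
move=> rho0 [clip_ln _ _].
have ln0 : 0 <= ln n%:R :> R.
  by rewrite -(pmulr_rge0 _ (clipped_gt0 rho0)); lra.
by have := ler_wpM2r ln0 (clipped_le_half rho); lra.
Qed.

Lemma ln_expr4_le_budget rho eps n : 0 < rho -> large_enough rho eps n ->
  9 * ln n%:R ^+ 4 <= (ln n%:R / rho) ^+ 10.
Proof.
move=> rho0 large_n; have ln_ge := large_ln_ge rho0 large_n.
have [_ _ rho2_le] := large_n.
have ln0 : 0 <= ln n%:R :> R by lra.
have ln_le : ln n%:R <= (ln n%:R / rho) ^+ 2.
  by rewrite expr_div_n ler_pdivlMr ?exprn_gt0 // [leRHS]expr2 ler_wpM2l.
apply: (@le_trans _ _ (ln n%:R ^+ 5)).
  by rewrite [leRHS]exprS ler_wpM2r ?exprn_ge0 //; lra.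
by rewrite (exprM _ 2 5) lerXn2r ?nnegrE ?sqr_ge0.
Qed.

Lemma exists_dp_alg rho (eps : R) n : 0 < rho -> 0 < eps ->
  exists A : rand_alg R n,
  [/\ edge_dp eps A,
      runs_within A (Num.sqrt n%:R * (ln n%:R / rho) ^+ 10) &
      large_enough rho eps n ->
      forall L G, numbering L -> 1 <= avg_degree R G ->
      ((1 - 5 / ln n%:R)%:E <= out_prob A L G
        [set x | (1 - rho) * avg_degree R G <= x
                 <= (1 + rho) * avg_degree R G]%R)%E].
Proof.
move=> rho0 eps0.
have [large_n|small_n] := pselect (large_enough rho eps n); last first.
  exists (const_alg n 0); split=> // [|L LP G w].
    exact/edge_dp_const_alg/ltW.
  by rewrite mulr_ge0 ?sqrtr_ge0 // exprn_even_ge0.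
have ln_ge := large_ln_ge rho0 large_n; have [clip_ln eps_ge _] := large_n.
have [A [A_dp A_time A_acc]] := exists_accurate_alg ln_ge (clipped_gt0 rho0)
  (clipped_le_half rho) clip_ln eps_ge.
exists A; split=> // [L LP G w|_ L G LP avg_ge1].
  apply: le_trans (A_time L LP G w) _; rewrite [9 * _]mulrC -mulrA.
  by rewrite ler_wpM2l ?sqrtr_ge0 //; exact: ln_expr4_le_budget large_n.
apply: A_acc => // x /= /andP[x_ge x_le].
have := ler_wpM2r (le_trans ler01 avg_ge1) (clipped_le rho).
by move=> clip_avg; apply/andP; split; lra.
Qed.

Lemma near_large_enough rho (eps : nat -> R) :
  0 < rho -> (forall n, 0 < eps n) ->
  (fun n => ((eps n)^-1)%R : R^o) =o_\oo
    (fun n => (ln n%:R `^ 4^-1)%R : R^o) ->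
  \forall n \near \oo, large_enough rho (eps n) n.
Proof.
move=> rho0 eps0 eps_o; near=> n.
have ln_ge1 : 1 <= ln n%:R :> R by near: n; exact: near_ln_ge.
have ln_gt0 : 0 < ln n%:R :> R by exact: lt_le_trans ln_ge1.
have inv_eps_le : (eps n)^-1 <= ln n%:R `^ 4^-1.
  near: n; have /eqoP/(_ 1 ltr01) := eps_o; apply: filterS => n.
  by rewrite mul1r !ger0_norm ?powR_ge0 // invr_ge0 ltW.
split; last by near: n; exact: near_ln_ge.
- rewrite mulrC -ler_pdivrMr ?clipped_gt0 //.
  by near: n; exact: near_ln_ge.
- rewrite -[eps n]invrK lef_pV2 ?posrE ?invr_gt0 //.
  apply: le_trans inv_eps_le _; rewrite -[leRHS](powRr1 (ltW ln_gt0)).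
  by apply: ler_powR => //; rewrite invf_le1 // ler1n.
Unshelve. all: by end_near.
Qed.

End Assembly.

Theorem theorem1 (R : realType) :
  exists (p q : {poly R}) (C : R) (N : nat),
  forall (rho : R) (eps : nat -> R),
    0 < rho ->
    (forall n, 0 < eps n) ->
    (fun n => ((eps n)^-1)%R : R^o) =o_\oo
      (fun n => (ln n%:R `^ 4^-1)%R : R^o) ->
  exists A : forall n, rand_alg R n,
    [/\ forall n, edge_dp (eps n) (A n),
        approximates_avg_degree rho A &
        forall n, (N <= n)%N ->
          runs_within (A n)
            (C * (Num.sqrt n%:R * p.[ln n%:R / rho] * q.[(eps n)^-1]))].
Proof.
exists 'X^10, 1, 1, 0%N => rho eps rho0 eps0 eps_o.
pose A n := cid (exists_dp_alg n rho0 (eps0 n)).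
have A_spec n := svalP (A n).
exists (fun n => sval (A n)); split=> [n|delta delta0|n _].
- by have [] := A_spec n.
- near=> n => L LP G avg_ge1.
  have large_n : large_enough rho (eps n) n.
    by near: n; exact: near_large_enough.
  have failure_le : 5 / ln n%:R <= delta.
    have ln_gt0 : 0 < ln n%:R :> R by have := large_ln_ge rho0 large_n; lra.
    rewrite ler_pdivrMr // mulrC -ler_pdivrMr //.
    by near: n; exact: near_ln_ge.
  have [_ _ /(_ large_n L G LP avg_ge1)] := A_spec n; apply: le_trans.
  by rewrite lee_fin lerB.
- by rewrite mul1r hornerXn hornerC mulr1; have [] := A_spec n.
Unshelve. all: by end_near.
Qed.
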